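(* Let $R$ be a semilocal commutative ring with $2\in R^\times$, let $(A,\sigma)$ be an Azumaya $R$-algebra with involution, let $\varepsilon\in Z(A)$ satisfy $\varepsilon^\sigma\varepsilon=1$, and let $(P,f)\in\mathcal H^\varepsilon(A,\sigma)$. Then the isometry group $U(f)$ acts transitively on $\mathrm{Lag}(f)$, provided $\mathrm{Lag}(f)$ is nonempty.
   Context: Conventions. Rings are commutative and unital, algebras are unital and associative, and $2$ is invertible in all rings and algebras. Involutions are written $a\mapsto a^\sigma$; $Z(A)$ is the center. An Azumaya $R$-algebra with involution is a pair $(A,\sigma)$ where $A$ is an $R$-algebra and $\sigma$ is an $R$-linear involution such that $A$ is projective as an $R$-module and separable as an $R$-algebra (equivalently, $A$ is Azumaya over $Z(A)$ and $Z(A)$ is finite étale over $R$), and $r\mapsto r\cdot 1_A$ identifies $R$ with $\{z\in Z(A):z^\sigma=z\}$. $\mathcal H^\varepsilon(A,\sigma)$ is the category of unimodular $\varepsilon$-hermitian spaces: pairs $(P,f)$ with $P$ a finitely generated projective right $A$-module and $f:P\times P\to A$ biadditive with $f(xa,yb)=a^\sigma f(x,y)b$, $f(x,y)=\varepsilon f(y,x)^\sigma$ and $x\mapsto f(x,-):P\to\mathrm{Hom}_A(P,A)$ bijective. $U(f)$ is the group of isometries of $(P,f)$ onto itself. A Lagrangian of $(P,f)$ is an $A$-module direct summand $L$ of $P$ with $L=L^\perp:=\{x\in P:f(x,L)=0\}$. For a finitely generated projective right $A$-module $Q$, $\mathrm{rrk}_AQ=\mathrm{rk}_{Z(A)}Q/\deg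 A$, with $\deg A=\sqrt{\mathrm{rk}_{Z(A)}A}$ (functions on $\mathrm{Spec}\,Z(A)$). $\mathrm{Lag}(f)$ is the set of Lagrangians $L$ of $(P,f)$ with $\mathrm{rrk}_AL=\frac12\mathrm{rrk}_AP$. *)

(* Defs.v *)
From HB Require Import structures.
From mathcomp Require Import all_boot all_order all_algebra ring_quotient.
From mathcomp Require Import algC.
From mathcomp Require Import boolp classical_sets cardinality.

Set Implicit Arguments.
Unset Strict Implicit.
Unset Printing Implicit Defensive.

Import GRing.Theory Num.Theory.

Local Open Scope ring_scope.

(* A right A-module is a left module over the converse ring A^c, with x * a
   encoded as (a : A^c) *: x. *)
Notation rmodType A := (lmodType (A : nzRingType)^c).

Definition rscale (A : nzRingType) (M : rmodType A) (x : M) (a : A) : M :=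
  (a : A^c) *: x.

Definition maximal_ideal (R : comNzRingType) (m : {pred R}) : Prop :=
  idealr_closed m /\
  forall J : {pred R}, idealr_closed J -> {subset m <= J} -> {subset J <= m}.

Definition semilocal (R : comNzRingType) : Prop :=
  finite_set [set m : R -> bool | maximal_ideal m]%classic.

Definition finitely_generated (R : nzRingType) (M : lmodType R) : Prop :=
  exists n (x : 'I_n -> M),
    forall y, exists c : 'I_n -> R, y = \sum_i c i *: x i.

Definition projective (R : nzRingType) (M : lmodType R) : Prop :=
  forall (N N' : lmodType R) (g : {linear N -> N'}) (h : {linear M -> N'}),
    (forall y, exists x, g x = y) ->
    exists k : {linear M -> N}, forall x, g (k x) = h x.

Definition submod_type (R : nzRingType) (M : lmodType R) (L : submodClosed M) :=
  {x : M | x \in L}.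

Section SubmodType.
Variables (R : nzRingType) (M : lmodType R) (L : submodClosed M).
HB.instance Definition _ := SubChoice.on (submod_type L).
HB.instance Definition _ :=
  GRing.SubChoice_isSubLmodule.Build R M (fun x => x \in L) (submod_type L)
    (GRing.subsemimodClosedP L).
End SubmodType.

Definition direct_summand (R : nzRingType) (M : lmodType R)
    (L : submodClosed M) : Prop :=
  exists L' : submodClosed M,
    (forall x, exists u v, [/\ u \in L, v \in L' & x = u + v]) /\
    (forall x, x \in L -> x \in L' -> x = 0).

Definition submod_image (R : nzRingType) (M N : lmodType R)
    (phi : {linear M -> N}) (L : submodClosed M) : {pred N} :=
  fun y => `[< exists2 x, x \in L & phi x = y >].

Lemma submod_image_closed (R : nzRingType) (M N : lmodType R)
    (phi : {linear M -> N}) (L : submodClosed M) :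
  subsemimod_closed (submod_image phi L).
Proof.
split; first split.
- by apply/asboolP; exists 0; rewrite ?rpred0 ?linear0.
- move=> u v /asboolP[x xL <-] /asboolP[y yL <-]; apply/asboolP.
  by exists (x + y); rewrite ?rpredD ?linearD.
- move=> a u /asboolP[x xL <-]; apply/asboolP.
  by exists (a *: x); rewrite ?rpredZ ?linearZ.
Qed.

HB.instance Definition _ (R : nzRingType) (M N : lmodType R)
    (phi : {linear M -> N}) (L : submodClosed M) :=
  GRing.isSubmodClosed.Build R N (submod_image phi L)
    (submod_image_closed phi L).

Definition central (A : nzRingType) : {pred A} :=
  fun z => `[< forall a : A, z * a = a * z >].
Arguments central : clear implicits.

Lemma centralP (A : nzRingType) (z : A) :
  reflect (forall a : A, z * a = a * z) (z \in central A).
Proof. exact: asboolP. Qed.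

Lemma central_subring (A : nzRingType) : subring_closed (central A).
Proof.
split=> [|x y /centralP cx /centralP cy|x y /centralP cx /centralP cy];
  apply/centralP => a.
- by rewrite mul1r mulr1.
- by rewrite mulrBl mulrBr cx cy.
- by rewrite -mulrA cy mulrA cx mulrA.
Qed.

Definition center (A : nzRingType) := {z : A | z \in central A}.

Section Center.
Variable A : nzRingType.
HB.instance Definition _ := SubChoice.on (center A).
HB.instance Definition _ :=
  GRing.SubChoice_isSubNzRing.Build A (fun z => z \in central A) (center A)
    (central_subring A).

Lemma center_mulC : commutative (@GRing.mul (center A)).
Proof.
move=> x y; apply: val_inj; rewrite !rmorphM /=.
by case: x => x /= /centralP.
Qed.

HB.instance Definition _ :=
  GRing.PzRing_hasCommutativeMul.Build (center A) center_mulC.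
End Center.

(* A right A-module with scalars restricted to Z(A). *)
Definition over_center (A : nzRingType) (M : rmodType A) : Type := M.

Section OverCenter.
Variables (A : nzRingType) (M : rmodType A).
HB.instance Definition _ := GRing.Zmodule.on (over_center M).

Definition over_center_scale (z : center A) (x : over_center M) :
  over_center M := rscale (x : M) (val z).

Lemma over_center_scaleA a b v :
  over_center_scale a (over_center_scale b v) = over_center_scale (a * b) v.
Proof.
rewrite mulrC /over_center_scale /rscale scalerA.
by congr (_ *: _); rewrite rmorphM.
Qed.

Lemma over_center_scale1 : left_id 1 over_center_scale.
Proof. by move=> v; rewrite /over_center_scale /rscale rmorph1 scale1r. Qed.

Lemma over_center_scaleDr : right_distributive over_center_scale +%R.
Proof. by move=> a u v; rewrite /over_center_scale /rscale scalerDr. Qed.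

Lemma over_center_scaleDl v : {morph over_center_scale^~ v : a b / a + b}.
Proof.
by move=> a b; rewrite /over_center_scale /rscale rmorphD /= scalerDl.
Qed.

HB.instance Definition _ :=
  GRing.Zmodule_isLmodule.Build (center A) (over_center M)
    over_center_scaleA over_center_scale1 over_center_scaleDr
    over_center_scaleDl.
End OverCenter.

(* The images of x_0, ..., x_(n-1) form a basis of the localization M_p over
   Z_p, with fractions cleared: the first clause says that they span M_p, the
   second that they are linearly independent.  Every finite basis of M_p becomes
   of this form after multiplying its members by units of Z_p. *)
Definition localized_basis (Z : comNzRingType) (M : lmodType Z)
    (p : prime_idealr Z) (n : nat) (x : 'I_n -> M) : Prop :=
  (forall m, exists s (c : 'I_n -> Z),
     s \notin p /\ s *: m = \sum_i c i *: x i) /\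
  (forall c : 'I_n -> Z, \sum_i c i *: x i = 0 ->
     forall i, exists2 s, s \notin p & s * c i = 0).

(* rk_Z M at p: the rank of the free Z_p-module M_p (junk value 0 when M_p is
   not free of finite rank, which does not occur for M finitely generated
   projective). *)
Definition rank (Z : comNzRingType) (M : lmodType Z) (p : prime_idealr Z) :
  nat :=
  xget 0%N
    [set n | exists x : 'I_n -> M, localized_basis p x]%classic.

(* deg A = sqrt (rk_Z(A) A), a function on Spec Z(A). *)
Definition degree (A : nzRingType) (p : prime_idealr (center A)) : algC :=
  sqrtC (rank (over_center (A^c)^o) p)%:R.

Definition rrk (A : nzRingType) (Q : rmodType A) (p : prime_idealr (center A)) :
  algC :=
  (rank (over_center Q) p)%:R / degree p.

(* A-A-bimodules on which the two induced R-actions agree; these are the same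
   thing as left modules over the enveloping algebra of A, the tensor product
   over R of A and A^c. *)
Record bimodule (R : comNzRingType) (A : algType R) := Bimodule {
  bimod_left :> lmodType A;
  ract : bimod_left -> A -> bimod_left;
  ractDl : forall m m' a, ract (m + m') a = ract m a + ract m' a;
  ractDr : forall m a a', ract m (a + a') = ract m a + ract m a';
  ract1 : forall m, ract m 1 = m;
  ractM : forall m a b, ract m (a * b) = ract (ract m a) b;
  lractA : forall a m b, ract (a *: m) b = a *: ract m b;
  ract_scalar : forall (r : R) m, ract m r%:A = (r%:A : A) *: m
}.

Definition bimod_morphism (R : comNzRingType) (A : algType R)
    (M N : bimodule A) (g : {linear M -> N}) : Prop :=
  forall m a, g (ract m a) = ract (g m) a.

Section RegularBimodule.
Variables (R : comNzRingType) (A : algType R).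

Lemma regular_ract_scalar (r : R) (m : A) : m * r%:A = r%:A * m.
Proof. by rewrite -scalerAr -scalerAl mulr1 mul1r. Qed.

Definition regular_bimodule : bimodule A :=
  @Bimodule R A A^o (fun m a => (m : A) * a)
    (fun m m' a => mulrDl (m : A) m' a) (fun m a a' => mulrDr (m : A) a a')
    (@mulr1 A) (fun m a b => mulrA (m : A) a b)
    (fun a m b => esym (mulrA a (m : A) b)) regular_ract_scalar.
End RegularBimodule.

(* A is separable over R: A is projective over its enveloping algebra. *)
Definition separable (R : comNzRingType) (A : algType R) : Prop :=
  forall (N N' : bimodule A) (g : {linear N -> N'})
         (h : {linear regular_bimodule A -> N'}),
    bimod_morphism g -> bimod_morphism h -> (forall y, exists x, g x = y) ->
    exists2 k : {linear regular_bimodule A -> N},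
      bimod_morphism k & forall x, g (k x) = h x.

Record azumaya_with_involution (R : comNzRingType) (A : algType R)
    (sigma : {linear A -> A}) : Prop := AzumayaWithInvolution {
  involution_antimul : forall a b, sigma (a * b) = sigma b * sigma a;
  involution_invol : involutive sigma;
  azumaya_projective : projective A;
  azumaya_separable : separable A;
  azumaya_scalar_inj : injective (fun r : R => r%:A : A);
  azumaya_fixed : forall z : A,
    z \in central A /\ sigma z = z <-> exists r : R, z = r%:A
}.

Record unimodular_hermitian (R : comNzRingType) (A : algType R)
    (sigma : {linear A -> A}) (eps : A) (P : rmodType A) (f : P -> P -> A) :
    Prop := UnimodularHermitian {
  herm_fg : finitely_generated P;
  herm_projective : projective P;
  herm_addl : forall x x' y, f (x + x') y = f x y + f x' y;
  herm_addr : forall x y y', f x (y + y') = f x y + f x y';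
  herm_sesqui : forall x y a b,
    f (rscale x a) (rscale y b) = sigma a * f x y * b;
  herm_sym : forall x y, f x y = eps * sigma (f y x);
  (* bijectivity of P -> Hom_A(P, A), x |-> f(x, -); the right module A_A is the
     regular module of A^c *)
  herm_unimodular : forall g : {linear P -> (A^c)^o},
    exists! x, forall y, f x y = g y
}.

(* phi is an element of U(f). *)
Definition isometry_group (A : nzRingType) (P : rmodType A) (f : P -> P -> A)
    (phi : {linear P -> P}) : Prop :=
  bijective phi /\ forall x y, f (phi x) (phi y) = f x y.

Definition lagrangian (A : nzRingType) (P : rmodType A) (f : P -> P -> A)
    (L : submodClosed P) : Prop :=
  direct_summand L /\
  forall x, x \in L <-> (forall y, y \in L -> f x y = 0).

Definition Lag (A : nzRingType) (P : rmodType A) (f : P -> P -> A)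
    (L : submodClosed P) : Prop :=
  lagrangian f L /\
  forall p : prime_idealr (center A),
    rrk (submod_type L) p = 2%:R^-1 * rrk P p.

(* Main.v *)
Require Import Defs.
From HB Require Import structures.
From mathcomp Require Import all_boot all_order all_algebra ring_quotient algC.
From mathcomp Require Import boolp classical_sets functions cardinality.
From mathcomp Require Import freeg ring.

(* Since 2 is invertible, every projection [p] of [P] onto a Lagrangian can be
   corrected, with the help of its adjoint [q], to [e = (1 + p - q) / 2], whose
   kernel is a complementary Lagrangian. Hence an isomorphism [L -> L'] extends
   to an isometry of [P], and it remains to show that [L] and [L'] are
   isomorphic [A]-modules. The centre [Z] of [A] is integral over [R] and hence
   semilocal, so by Nakayama's lemma it suffices to find, for each maximal
   ideal [m] of [Z], a morphism [L -> L'] that is bijective modulo [m]; such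
   morphisms are glued together by the Chinese remainder theorem. Modulo [m],
   [L] and [L'] become representations of [A] over [Z / m] of the same
   dimension, and averaging with a separability idempotent [sum x_i (x) y_i] of
   [A] shows that these are semisimple and isomorphic. The same averaging, [a
   |-> sum x_i a y_i], yields enough [Z]-linear forms on projective [A]-modules
   to make them locally free over [Z], so that the ranks in the definition of
   [rrk] are genuine. *)

Set Implicit Arguments.
Unset Strict Implicit.
Unset Printing Implicit Defensive.

Import GRing.Theory Num.Theory.

Local Open Scope ring_scope.

(** * Separability idempotents *)

(** The rank condition in [Lag] must be read over the center [Z], not over [R]: if [A = R x R] with
    the exchange involution, [f] pairs a module [Q] with its dual, and each summand [L1] of [Q]
    gives a Lagrangian [L1 x L1^perp], of any rank. Equal residual dimension suffices because [Z]
    acts on both modules through the same character, so that both live over one central separable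
    algebra. The simplicity of that algebra enters only through [ideal_central_unit]: a two-sided
    ideal acts as zero or contains an element acting as a nonzero scalar. Integrality of [Z] comes
    from the involution: [z] is a root of [X^2 - (z + z^sigma) X + z z^sigma], whose coefficients
    are fixed, hence in [R]. The factor 1/2 makes [e] and its adjoint add up to 1, so that the
    kernel of [e] is isotropic and [f] identifies it with the dual of [L]. *)

Definition dual_basis (S : nzRingType) (M : lmodType S) : Prop :=
  exists n (u : 'I_n -> M) (psi : 'I_n -> {linear M -> S^o}),
    forall v, v = \sum_i (psi i v : S) *: u i.

(** The second clause is the equation [a e = e a] in the tensor product of [A] with itself over [R],
    tested against every balanced biadditive map; the universal property thus replaces the tensor
    product. *)
Definition separability_family (R : comNzRingType) (A : algType R)
    (e : seq (A * A)) : Prop :=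
  \sum_(q <- e) q.1 * q.2 = 1 /\
  forall (V : zmodType) (B : A -> A -> V),
    (forall x x' y, B (x + x') y = B x y + B x' y) ->
    (forall x y y', B x (y + y') = B x y + B x y') ->
    (forall r x y, B (r *: x) y = B x (r *: y)) ->
    forall a, \sum_(q <- e) B (a * q.1) q.2 = \sum_(q <- e) B q.1 (q.2 * a).

Section Separability.
Variables (R : comNzRingType) (A : algType R).

Definition functional_tensor (s : seq (A * A)) : {linear A -> R^o} -> A^o :=
  fun phi => \sum_(q <- s) (phi q.2 : R) *: q.1.

(* A stand-in for the tensor product of A with itself over R: the tensor
   sum x_i (x) y_i is seen through the map phi |-> sum phi(y_i) x_i and through
   its product; no quotient is needed, and when A is projective over R the first
   component loses no information. *)
Definition tensor_pred : {pred (({linear A -> R^o} -> A^o) * A^o)%type} :=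
  fun w => `[< exists s : seq (A * A),
    w = (functional_tensor s, \sum_(q <- s) q.1 * q.2) >].

Lemma tensor_closed : subsemimod_closed tensor_pred.
Proof.
split; first split.
- apply/asboolP; exists [::]; rewrite big_nil; congr pair.
  by apply/funext => phi; rewrite /functional_tensor big_nil.
- move=> _ _ /asboolP[s ->] /asboolP[t ->]; apply/asboolP; exists (s ++ t).
  rewrite big_cat; congr pair; apply/funext => phi.
  by rewrite /functional_tensor big_cat.
- move=> a _ /asboolP[s ->]; apply/asboolP.
  exists [seq (a * q.1, q.2) | q <- s]; rewrite big_map; congr pair.
    apply/funext => phi; rewrite /functional_tensor big_map.
    rewrite [LHS]scaler_sumr; apply: eq_bigr => q _.
    by rewrite -[LHS]scalerAr.
  by rewrite /= [LHS]scaler_sumr; apply: eq_bigr => q _; rewrite -mulrA.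
Qed.
HB.instance Definition _ := GRing.isSubmodClosed.Build A _ tensor_pred
  tensor_closed.

Definition precomp_mull (phi : {linear A -> R^o}) (b x : A) : R^o :=
  phi (b * x).

Lemma precomp_mull_linear phi b : linear (precomp_mull phi b).
Proof. by move=> r x y; rewrite /precomp_mull mulrDr -scalerAr linearP. Qed.
HB.instance Definition _ phi b := GRing.isLinear.Build R A R^o *:%R
  (precomp_mull phi b) (precomp_mull_linear phi b).

Definition precomp_mulr (phi : {linear A -> R^o}) (b x : A) : R^o :=
  phi (x * b).

Lemma precomp_mulr_linear phi b : linear (precomp_mulr phi b).
Proof. by move=> r x y; rewrite /precomp_mulr mulrDl -scalerAl linearP. Qed.
HB.instance Definition _ phi b := GRing.isLinear.Build R A R^o *:%R
  (precomp_mulr phi b) (precomp_mulr_linear phi b).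

Definition tensor_act (w : ({linear A -> R^o} -> A^o) * A^o) (b : A) :
    ({linear A -> R^o} -> A^o) * A^o :=
  (fun phi => w.1 (precomp_mulr phi b), (w.2 : A) * b).

Lemma tensor_act_closed w b :
  w \in tensor_pred -> tensor_act w b \in tensor_pred.
Proof.
move=> /asboolP[s ->]; apply/asboolP; exists [seq (q.1, q.2 * b) | q <- s].
rewrite /tensor_act /= big_map mulr_suml; congr pair; last first.
  by apply: eq_bigr => q _; rewrite mulrA.
by apply/funext => phi; rewrite /functional_tensor big_map.
Qed.

Definition tensor_ract (m : submod_type tensor_pred) (b : A) :
  submod_type tensor_pred :=
  Sub (tensor_act (val m) b) (tensor_act_closed b (valP m)).

Lemma tensor_ract_scalar r m : tensor_ract m r%:A = (r%:A : A) *: m.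
Proof.
apply: val_inj; rewrite /=; case: m => _ /= /asboolP[s ->].
rewrite /tensor_act /=; congr pair; last exact: regular_ract_scalar.
apply/funext => phi; rewrite /functional_tensor /= [RHS]scaler_sumr.
apply: eq_bigr => q _ /=.
rewrite /precomp_mulr -scalerAr mulr1 linearZ /=.
by rewrite [RHS]mulr_algl [RHS]scalerA.
Qed.

Definition tensor_bimodule : bimodule A.
Proof.
refine (@Bimodule R A (submod_type tensor_pred) tensor_ract
  _ _ _ _ _ tensor_ract_scalar).
- move=> m m' a; apply: val_inj; rewrite [RHS]raddfD /= /tensor_act /=.
  by congr pair; rewrite -[RHS]mulrDl.
- move=> [w P] a a'; apply: val_inj => /=; case/asboolP: P => s ->.
  congr pair => /=; last exact: mulrDr.
  apply/funext => phi; rewrite /functional_tensor -[RHS]big_split /=.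
  by apply: eq_bigr => q _; rewrite /= /precomp_mulr mulrDr linearD scalerDl.
- move=> m; apply: val_inj; rewrite /= /tensor_act /= mulr1.
  case: m => _ /= /asboolP[s ->] /=; congr pair; apply/funext => phi.
  rewrite /functional_tensor; apply: eq_bigr => q _.
  by rewrite /= /precomp_mulr mulr1.
- move=> m a b; apply: val_inj; rewrite /= /tensor_act /= mulrA.
  case: m => _ /= /asboolP[s ->] /=; congr pair; apply/funext => phi.
  rewrite /functional_tensor; apply: eq_bigr => q _.
  by rewrite /= /precomp_mulr mulrA.
- move=> a m b; apply: val_inj; rewrite [RHS]linearZ /= /tensor_act /=.
  by congr pair; rewrite -[LHS]mulrA.
Defined.

Definition tensor_mul (m : tensor_bimodule) : regular_bimodule A :=
  (val (m : submod_type tensor_pred)).2.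

Lemma tensor_mul_linear : linear tensor_mul.
Proof. by []. Qed.
HB.instance Definition _ := GRing.isLinear.Build A tensor_bimodule
  (regular_bimodule A) *:%R tensor_mul tensor_mul_linear.

(** Separability lifts the identity of [A] through the product map to a bimodule section [h]. The
    tensor [h 1] has product 1, and [a (h 1) = h a = (h 1) a] because [h] is linear on both
    sides. *)
Lemma separable_functional : separable A -> exists e : seq (A * A),
  \sum_(q <- e) q.1 * q.2 = 1 /\
  forall (phi : {linear A -> R^o}) a,
    \sum_(q <- e) (phi q.2 : R) *: (a * q.1) =
    \sum_(q <- e) (phi (q.2 * a) : R) *: q.1.
Proof.
move=> sepA.
have id_bimod : bimod_morphism (M := regular_bimodule A)
  (N := regular_bimodule A) (idfun : {linear _ -> _}) by [].
have mul_bimod : bimod_morphism (tensor_mul : {linear _ -> _}) by [].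
have mul_surj y : exists x, (tensor_mul : {linear _ -> _}) x = y.
  pose w : ({linear A -> R^o} -> A^o) * A^o :=
    (functional_tensor [:: (y : A, 1)], y).
  have P : w \in tensor_pred.
    by apply/asboolP; exists [:: (y : A, 1)]; rewrite big_seq1 mulr1.
  by exists (Sub w P : submod_type tensor_pred).
have [h hbi hmul] := sepA _ _ _ _ mul_bimod id_bimod mul_surj.
have eq_h a : (a *: h 1 : tensor_bimodule) = ract (h 1) a.
  by rewrite -linearZ -hbi /=; congr (h _); rewrite /= mul1r [LHS]mulr1.
pose m : submod_type tensor_pred := h 1.
have /asboolP[s ms] := valP m.
exists s; split=> [|phi a].
  by have := hmul 1; rewrite /= /tensor_mul -/m ms.
transitivity (a *: (functional_tensor s phi : A^o)).
  rewrite [RHS]scaler_sumr; apply: eq_bigr => q _; exact: scalerAr.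
have := congr1 (fun m : submod_type tensor_pred => (val m).1 phi) (eq_h a).
by rewrite /= -/m ms.
Qed.
End Separability.

(** * Finite generation of projective separable algebras *)

Section FreeCover.
Variables (S : comNzRingType) (M : lmodType S).

Lemma fglift_linear : linear (fglift idfun : {freeg M / S} -> M).
Proof.
move=> c x y; have addl : additive (fglift idfun : {freeg M / S} -> M).
  exact: lift_is_additive.
have addlD u v : fglift idfun (u + v : {freeg M / S}) =
    fglift idfun u + fglift idfun v :> M.
  have l0 : fglift idfun (0 : {freeg M / S}) = 0 :> M.
    by rewrite -[X in fglift _ X](subrr 0) addl subrr.
  have := addl u (- v); rewrite opprK => ->.
  by have := addl 0 v; rewrite l0 !sub0r => ->; rewrite opprK.
rewrite addlD; congr (_ + _); have -> : c *: x = fgscale c x by [].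
rewrite -[in RHS](freeg_sumE x).
have l0 : fglift idfun (0 : {freeg M / S}) = 0 :> M.
  by rewrite -[X in fglift _ X](subrr 0) addl subrr.
rewrite /fgscale !(big_morph (fglift idfun) addlD l0) scaler_sumr.
by apply: eq_bigr => z _; rewrite !liftU scalerA.
Qed.

HB.instance Definition _ := GRing.isLinear.Build S {freeg M / S} M *:%R
  (fglift idfun) fglift_linear.

Definition coefficient (w : M) (x : {freeg M / S}) : S^o := coeff w x.

Lemma coefficient_linear w : linear (coefficient w).
Proof. by move=> c x y; rewrite /coefficient coeffD coeffZ. Qed.

HB.instance Definition _ w := GRing.isLinear.Build S {freeg M / S} S^o *:%R
  (coefficient w) (coefficient_linear w).

(** [projective] contains no finiteness, so the cover is the free module on all elements of [M]: one
    coordinate form per element, with a finite support [D v] that varies with [v]. *)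
Lemma projective_functionals : projective M ->
  exists (phi : M -> {linear M -> S^o}) (D : M -> seq M), forall v,
    [/\ uniq (D v), forall w, w \notin D v -> phi w v = 0 &
        v = \sum_(w <- D v) (phi w v : S) *: w].
Proof.
move=> projM; have surj y : exists x, (fglift idfun : {linear _ -> M}) x = y.
  by exists (freeg.Freeg [:: (1, y)]); rewrite /= liftU scale1r.
have [k kK] := projM _ _ _ (idfun : {linear M -> M}) surj.
exists (fun w => coefficient w \o k : {linear M -> S^o}).
exists (fun v => dom (k v)) => v; split; first exact: uniq_dom.
  by move=> w; apply: coeff_outdom.
rewrite -[LHS]kK /= -[X in fglift _ X]freeg_sumE (raddf_sum (fglift idfun)).
by apply: eq_bigr => z _; rewrite /= liftU.
Qed.
End FreeCover.

Lemma big_widen_seq (V : nmodType) (I : eqType) (s E : seq I) (F : I -> V) :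
  uniq s -> uniq E -> {subset s <= E} ->
  (forall w, w \in E -> w \notin s -> F w = 0) ->
  \sum_(w <- s) F w = \sum_(w <- E) F w.
Proof.
move=> us uE sE F0.
rewrite [RHS](bigID (mem s)) /= [X in _ = _ + X]big1_seq ?addr0.
  rewrite -[RHS]big_filter; apply: perm_big; apply: uniq_perm => //.
    exact: filter_uniq.
  by move=> w; rewrite mem_filter /=; case: (boolP (w \in s)) => //= /sE ->.
by move=> w /andP[/F0 Fw /Fw].
Qed.

(** A projective separable algebra is finitely generated (Villamayor and Zelinsky). Once a finite
    dual basis is available, the identity of [separable_functional] extends from functionals to all
    balanced maps. *)
Lemma separable_finite (R : comNzRingType) (A : algType R) :
  projective A -> separable A ->
  exists2 s : seq (A * {linear A -> R^o}),
    (forall a, a = \sum_(q <- s) (q.2 a : R) *: q.1) &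
    exists e : seq (A * A), separability_family e.
Proof.
move=> projA sepA; have [e [e1 eB]] := separable_functional sepA.
have [phi [D phiD]] := projective_functionals projA.
(* By centrality of the idempotent, sum phi_w(y_i a) x_i = sum phi_w(y_i) a x_i,
   which vanishes unless w belongs to the finite set F, whatever a is. *)
pose F := undup (flatten [seq D q.2 | q <- e]).
have phi_tensor a : a = \sum_(w <- F) \sum_(q <- e)
    (phi w (q.2 * a) : R) *: (q.1 * w).
  pose E := undup (F ++ flatten [seq D (q.2 * a) | q <- e]).
  transitivity (\sum_(w <- E) \sum_(q <- e) (phi w (q.2 * a) : R) *: (q.1 * w)).
    rewrite exchange_big /= -[LHS]mul1r -e1 mulr_suml big_seq [RHS]big_seq.
    apply: eq_bigr => q qe; rewrite -mulrA.
    have [uD D0 DE] := phiD (q.2 * a).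
    rewrite [in LHS]DE mulr_sumr.
    transitivity (\sum_(w <- D (q.2 * a)) (phi w (q.2 * a) : R) *: (q.1 * w)).
      by apply: eq_bigr => w _; rewrite -scalerAr.
    apply: big_widen_seq => //; first exact: undup_uniq.
      move=> w wD; rewrite mem_undup mem_cat; apply/orP; right.
      by apply/flattenP; exists (D (q.2 * a)) => //; apply: map_f.
    by move=> w _ /D0 ->; rewrite scale0r.
  apply/esym; apply: big_widen_seq; rewrite ?undup_uniq //.
    by move=> w wF; rewrite mem_undup mem_cat wF.
  move=> w _ wF.
  transitivity (\sum_(q <- e) ((phi w (q.2 * a) : R) *: q.1) * w).
    by apply: eq_bigr => q _; rewrite -scalerAl.
  rewrite -mulr_suml -eB big_seq big1 ?mul0r // => q qe.
  have [_ D0 _] := phiD q.2; rewrite D0 ?scale0r //.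
  apply: contra wF => wD; rewrite mem_undup; apply/flattenP.
  by exists (D q.2) => //; apply: map_f.
pose s : seq (A * {linear A -> R^o}) :=
  [seq (q.1 * w, precomp_mull (phi w) q.2 : {linear _ -> _}) | w <- F, q <- e].
have sE a : a = \sum_(q <- s) (q.2 a : R) *: q.1.
  by rewrite [LHS]phi_tensor /s big_allpairs_dep.
exists s => //; exists e; split=> // V B BDl BDr Bbal a.
have B0 x : B x 0 = 0.
  by apply: (addrI (B x 0)); rewrite -BDr !addr0.
have B0l y : B 0 y = 0.
  by apply: (addrI (B 0 y)); rewrite -BDl !addr0.
(* Expanding [y] in the dual basis and moving its coefficients to the left leaves maps that are
   additive in the first argument, to which [eB] applies. *)
have BE x y : B x y = \sum_(q <- s) B ((q.2 y : R) *: x) q.1.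
  rewrite [in LHS](sE y) (big_morph (B x) (BDr x) (B0 x)).
  by apply: eq_bigr => q _; rewrite Bbal.
under eq_bigr do rewrite BE; under [RHS]eq_bigr do rewrite BE.
rewrite exchange_big [RHS]exchange_big /=; apply: eq_bigr => q _.
rewrite -!(big_morph (B^~ q.1) (fun x x' => BDl x x' q.1) (B0l q.1)).
by rewrite eB.
Qed.

(** * Representations over a residue field *)

(** A matrix of maximal rank among those with all rows in [S] works: a vector of [S] outside its row
    space would raise the rank. *)
Lemma subspace_row_space (k : fieldType) n (S : 'rV[k]_n -> Prop) :
  S 0 -> (forall c u v, S u -> S v -> S (c *: u + v)) ->
  exists W : 'M[k]_n, forall v, S v <-> (v <= W)%MS.
Proof.
move=> S0 SP.
pose Q r := `[< exists2 W : 'M[k]_n, (forall i, S (row i W)) & \rank W = r >].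
have Q0 : exists r, Q r.
  exists 0%N; apply/asboolP; exists 0; last exact: mxrank0.
  by move=> i; rewrite row0.
have Qn r : Q r -> (r <= n)%N by move=> /asboolP[W _ <-]; exact: rank_leq_row.
have [r /asboolP[W SW rW] rmax] := ex_maxnP Q0 Qn.
have SW' v : (v <= W)%MS -> S v.
  move=> /submxP[c ->]; rewrite mulmx_sum_row.
  apply: big_ind => // [x y Sx Sy|i _]; first by rewrite -[x]scale1r; apply: SP.
  by rewrite -[_ *: _]addr0; apply: SP.
exists W => v; split=> [Sv|]; last exact: SW'.
case: (boolP (v <= W)%MS) => // vW; exfalso.
have SU u : (u <= W + v)%MS -> S u.
  case/sub_addsmxP => -[u1 u2] /= ->; rewrite -[u1 *m W]scale1r.
  apply: (SP); first by apply: SW'; exact: submxMl.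
  rewrite [u2]mx11_scalar mul_scalar_mx -[_ *: _]addr0; exact: SP.
have : (\rank (W + v)%MS <= r)%N.
  apply: rmax; apply/asboolP; exists (W + v)%MS => // i; apply: SU.
  exact: row_sub.
rewrite leqNgt -rW; case/negP; apply: rank_ltmx.
by rewrite ltmxE addsmxSl addsmx_sub submx_refl /= vW.
Qed.

Section Representation.
Variables (R : comNzRingType) (A : algType R) (e : seq (A * A)).
Hypothesis sep_e : separability_family e.
Variables (k : fieldType) (chi : {rmorphism center A -> k}).
Hypothesis chi_surj : forall t, exists z, chi z = t.

(** The projection of [A] onto its center given by [e]. It fixes the center, and is in general not
    the reduced trace. *)
Definition trace_val (a : A) : A := \sum_(q <- e) q.1 * a * q.2.

Lemma trace_central a : trace_val a \in central A.
Proof.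
apply/centralP => b; rewrite /trace_val mulr_suml mulr_sumr.
transitivity (\sum_(q <- e) q.1 * a * (q.2 * b)).
  by apply: eq_bigr => q _; rewrite mulrA.
rewrite -(sep_e.2 A (fun x y => x * a * y)).
- by apply: eq_bigr => q _; rewrite !mulrA.
- by move=> x x' y; rewrite !mulrDl.
- by move=> x y y'; rewrite mulrDr.
- by move=> r x y; rewrite -!scalerAl -!scalerAr.
Qed.

Definition trace (a : A) : center A := Sub (trace_val a) (trace_central a).

Lemma trace_val_central z : z \in central A -> trace_val z = z.
Proof.
move=> /centralP zC; rewrite -[RHS]mulr1 -sep_e.1 mulr_sumr.
by apply: eq_bigr => q _; rewrite -zC mulrA.
Qed.

Record representation n (rho : A -> 'M[k]_n) : Prop := Representation {
  repD : forall a b, rho (a + b) = rho a + rho b;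
  repM : forall a b, rho (a * b) = rho a *m rho b;
  rep_center : forall z, rho (val z) = (chi z)%:M
}.

Section OneRep.
Variables (n : nat) (rho : A -> 'M[k]_n).
Hypothesis rho_rep : representation rho.

Lemma rep0 : rho 0 = 0.
Proof. by apply: (addrI (rho 0)); rewrite -(repD rho_rep) !addr0. Qed.

Lemma rep_one : rho 1 = 1%:M.
Proof.
have -> : (1 : A) = val (1 : center A) by [].
by rewrite (rep_center rho_rep) rmorph1.
Qed.

Lemma rep_sum I (r : seq I) (F : I -> A) :
  rho (\sum_(i <- r) F i) = \sum_(i <- r) rho (F i).
Proof. exact: (big_morph rho (repD rho_rep) rep0). Qed.

Lemma repZ (z : center A) a : rho (val z * a) = chi z *: rho a.
Proof. by rewrite (repM rho_rep) (rep_center rho_rep) mul_scalar_mx. Qed.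
End OneRep.

Lemma scalar_in_center (r : R) : (r%:A : A) \in central A.
Proof. by apply/centralP => a; rewrite mulr_algl -scalerAr mulr1. Qed.

Lemma repZ2 n1 n2 (rho1 : A -> 'M[k]_n1) (rho2 : A -> 'M[k]_n2) (r : R) :
  representation rho1 -> representation rho2 -> exists c : k,
  (forall a, rho1 (r *: a) = c *: rho1 a) /\
  (forall a, rho2 (r *: a) = c *: rho2 a).
Proof.
move=> rep1 rep2; pose z : center A := Sub r%:A (scalar_in_center r).
by exists (chi z); split=> a; rewrite -mulr_algl (repZ _ z).
Qed.

Section Average.
Variables (n1 n2 : nat) (rho1 : A -> 'M[k]_n1) (rho2 : A -> 'M[k]_n2).
Hypotheses (rep1 : representation rho1) (rep2 : representation rho2).

Lemma balanced_rep (pi : 'M[k]_n1 -> 'M[k]_(n1, n2)) :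
  (forall c X Y, pi (c *: X + Y) = c *: pi X + pi Y) ->
  forall a, \sum_(q <- e) pi (rho1 (a * q.1)) *m rho2 q.2 =
            \sum_(q <- e) pi (rho1 q.1) *m rho2 (q.2 * a).
Proof.
move=> piP a.
have piD X Y : pi (X + Y) = pi X + pi Y by rewrite -[X]scale1r piP !scale1r.
have pi0 : pi 0 = 0 by apply: (addrI (pi 0)); rewrite -piD !addr0.
have piZ c X : pi (c *: X) = c *: pi X by rewrite -[c *: X]addr0 piP pi0 addr0.
apply: (sep_e.2 _ (fun x y => pi (rho1 x) *m rho2 y)).
- by move=> x x' y; rewrite (repD rep1) piD mulmxDl.
- by move=> x y y'; rewrite (repD rep2) mulmxDr.
- move=> r x y; have [c [-> ->]] := repZ2 r rep1 rep2.
  by rewrite piZ -scalemxAl -scalemxAr.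
Qed.

Definition average (X : 'M[k]_(n1, n2)) : 'M[k]_(n1, n2) :=
  \sum_(q <- e) rho1 q.1 *m X *m rho2 q.2.

Lemma averageC X a : rho1 a *m average X = average X *m rho2 a.
Proof.
have := @balanced_rep (mulmxr X) (fun c Y Y' => linearP (mulmxr X) c Y Y') a.
rewrite /= mulmx_sumr mulmx_suml => H.
under eq_bigr do rewrite !mulmxA -(repM rep1); rewrite H.
by apply: eq_bigr => q _; rewrite (repM rep2) mulmxA.
Qed.

Lemma average_submx m (W : 'M[k]_(m, n2)) X :
  (forall a, W *m rho2 a <= W)%MS -> (X <= W)%MS -> (average X <= W)%MS.
Proof.
move=> stW XW; apply: summx_sub => q _; rewrite -mulmxA.
apply: submx_trans (submxMl _ _) _.
by apply: submx_trans (submxMr _ XW) (stW _).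
Qed.
End Average.

Lemma average_fix n m (rho : A -> 'M[k]_n) (W : 'M[k]_(m, n)) X :
  representation rho ->
  (forall a, W *m rho a *m X = W *m rho a) -> W *m average rho rho X = W.
Proof.
move=> rep WX; rewrite mulmx_sumr.
under eq_bigr do rewrite !mulmxA WX -mulmxA -(repM rep).
by rewrite -mulmx_sumr -(rep_sum rep) sep_e.1 (rep_one rep) mulmx1.
Qed.

(* The average of an A-linear projection onto the two-sided ideal I, obtained
   itself by averaging a k-linear projection. *)
Lemma ideal_central_unit n (rho : A -> 'M[k]_n) (I : A -> Prop) :
  representation rho -> I 0 ->
  (forall a b, I a -> I b -> I (a + b)) ->
  (forall a b, I a -> I (b * a)) -> (forall a b, I a -> I (a * b)) ->
  exists2 c : center A, I (val c) & forall x, I x -> rho x = chi c *: rho x.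
Proof.
move=> rep I0 ID IMl IMr.
have Isum (J : Type) (r : seq J) (F : J -> A) :
    (forall i, I (F i)) -> I (\sum_(i <- r) F i).
  by move=> IF; apply: big_ind.
pose S (v : 'rV[k]_(n * n)) := exists2 x, I x & v = mxvec (rho x).
have [|c u v [x Ix ->] [y Iy ->]|W WP] := @subspace_row_space k _ S.
- by exists 0 => //; rewrite (rep0 rep) linear0.
- have [z <-] := chi_surj c; exists (val z * x + y); first by apply: ID; auto.
  by rewrite (repD rep) (repZ rep) linearP.
pose pi (X : 'M[k]_n) : 'M[k]_n := vec_mx (mxvec X *m (pinvmx W *m W)).
have piP c X Y : pi (c *: X + Y) = c *: pi X + pi Y.
  by rewrite /pi linearP mulmxDl -scalemxAl linearP.
have piI X : exists2 x, I x & pi X = rho x.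
  have /WP[x Ix E] : (mxvec X *m (pinvmx W *m W) <= W)%MS.
    by rewrite mulmxA submxMl.
  by exists x => //; rewrite /pi E mxvecK.
have pi_id x : I x -> pi (rho x) = rho x.
  by move=> Ix; rewrite /pi mulmxA mulmxKpV ?mxvecK //; apply/WP; exists x.
have [w wI wE] : exists2 w : A -> A, forall x, I (w x)
    & forall x, pi (rho x) = rho (w x).
  have /choice[w wP] : forall x, exists y, I y /\ pi (rho x) = rho y.
    by move=> x; have [y] := piI (rho x); exists y.
  by exists w => x; have [] := wP x.
(* [w] lifts [pi] to elements of [I], so [rho c0] is the sum of the [pi (rho x_i) *m rho y_i]; it
   acts as a left identity on [rho I]. *)
pose c0 := \sum_(q <- e) w q.1 * q.2.
have c0I : I c0 by apply: Isum => q; exact: IMr.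
have c0P x : I x -> rho (c0 * x) = rho x.
  move=> Ix; rewrite mulr_suml (rep_sum rep).
  under eq_bigr do rewrite -mulrA (repM rep) -wE.
  rewrite -(balanced_rep rep rep piP).
  transitivity (\sum_(q <- e) rho (x * (q.1 * q.2))).
    apply: eq_bigr => q _; rewrite pi_id; last exact: IMr.
    by rewrite -(repM rep) mulrA.
  by rewrite -(rep_sum rep) -mulr_sumr sep_e.1 mulr1.
(* Averaging makes [c0] central and keeps it in [I]. As [y_i x] lies in [I], the factor [c0] of
   [x_i c0 y_i x] disappears under [rho]. *)
exists (trace c0); first by apply: Isum => q; apply: IMr; exact: IMl.
move=> x Ix; rewrite -(repZ rep) /= mulr_suml (rep_sum rep).
apply: esym; transitivity (\sum_(q <- e) rho (q.1 * q.2 * x)).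
  apply: eq_bigr => q _; rewrite -!mulrA !(repM rep).
  rewrite -[in LHS](repM rep) -[in LHS](repM rep).
  by rewrite c0P -?(repM rep) //; exact: IMl.
by rewrite -(rep_sum rep) -mulr_suml sep_e.1 mul1r.
Qed.

(** If every average vanishes, consider the two-sided ideal of all [a] with [q *m rho2 a = 0]. The
    central element found in it has [chi] equal to 0 because [q] is nonzero, so the ideal acts as
    zero through [rho1]; the vanishing averages then force [p = 0]. *)
Lemma average_neq0 n1 n2 (rho1 : A -> 'M[k]_n1) (rho2 : A -> 'M[k]_n2)
    (p : 'M[k]_n1) (q : 'M[k]_n2) :
  representation rho1 -> representation rho2 ->
  (forall a, rho1 a *m p = p *m rho1 a) ->
  (forall a, rho2 a *m q = q *m rho2 a) -> p != 0 -> q != 0 ->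
  exists X, average rho1 rho2 (p *m X *m q) != 0.
Proof.
move=> rep1 rep2 pC qC p0 q0; apply: contrapT => av0.
have {}av0 X : average rho1 rho2 (p *m X *m q) = 0.
  by apply/eqP/negPn/negP => ?; apply: av0; exists X.
have [|a b Ia Ib|a b Ia|a b Ia|c cI cP] :=
  @ideal_central_unit _ rho1 (fun a => q *m rho2 a = 0) rep1.
- by rewrite (rep0 rep2) mulmx0.
- by rewrite (repD rep2) mulmxDr Ia Ib addr0.
- by rewrite (repM rep2) mulmxA -qC -mulmxA Ia mulmx0.
- by rewrite (repM rep2) mulmxA Ia mul0mx.
have chic : chi c = 0.
  move: cI; rewrite (rep_center rep2) mul_mx_scalar => /eqP.
  by rewrite scaler_eq0 (negPf q0) orbF => /eqP.
have I_rho1 x : q *m rho2 x = 0 -> rho1 x = 0.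
  by move=> /cP ->; rewrite chic scale0r.
have [zeta zetaP] := choice chi_surj.
(* For [X = delta_mx j r], entry [(i, s)] of the vanishing average is entry [(r, s)] of
   [q *m rho2 x], where [x] combines the second components of [e] with lifts of the coefficients
   shown. Hence [x] lies in the ideal. *)
have coord0 i j : \sum_(t <- e) (rho1 t.1 *m p) i j *: rho1 t.2 = 0.
  pose x := \sum_(t <- e) val (zeta ((rho1 t.1 *m p) i j)) * t.2.
  have xE m (rho : A -> 'M_m) : representation rho ->
      rho x = \sum_(t <- e) (rho1 t.1 *m p) i j *: rho t.2.
    by move=> rep; rewrite (rep_sum rep); apply: eq_bigr => t _;
       rewrite (repZ rep) zetaP.
  rewrite -xE //; apply: I_rho1; rewrite xE // mulmx_sumr.
  apply/matrixP => r s.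
  have := congr1 (fun M : 'M_(_, _) => M i s) (av0 (delta_mx j r)).
  rewrite !mxE !summxE => H; rewrite -[RHS]H; apply: eq_bigr => t _.
  rewrite !mulmxA -[X in _ = (X *m _) _ _]mulmxA -mulmxA -scalemxAr [LHS]mxE.
  rewrite mulmxA.
  rewrite -(mul_delta_mx (0 : 'I_1)) !mulmxA -colE -mulmxA -mulmxA -rowE.
  by rewrite [RHS]mxE big_ord1 !mxE.
case/eqP: p0; have: average rho1 rho1 p = p.
  rewrite /average; under eq_bigr do rewrite pC -mulmxA -(repM rep1).
  by rewrite -mulmx_sumr -(rep_sum rep1) sep_e.1 (rep_one rep1) mulmx1.
move=> <-; apply/matrixP => i j; rewrite summxE !mxE.
under eq_bigr do rewrite mxE.
rewrite exchange_big big1 // => r _.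
have := congr1 (fun M : 'M_(_, _) => M r j) (coord0 i r).
rewrite summxE mxE => H; rewrite -[RHS]H.
by apply: eq_bigr => t _; rewrite [RHS]mxE.
Qed.

Lemma representation_iso n (rho1 rho2 : A -> 'M[k]_n) :
  representation rho1 -> representation rho2 ->
  exists2 H : 'M[k]_n, H \in unitmx & forall a, rho1 a *m H = H *m rho2 a.
Proof.
move=> rep1 rep2.
pose inter (H : 'M[k]_n) := forall a, rho1 a *m H = H *m rho2 a.
pose Q r := `[< exists2 H, inter H & \rank H = r >].
have Q0 : exists r, Q r.
  exists 0%N; apply/asboolP; exists 0; last exact: mxrank0.
  by move=> a; rewrite mulmx0 mul0mx.
have Qn r : Q r -> (r <= n)%N by move=> /asboolP[H _ <-]; exact: rank_leq_row.
(* If an intertwiner H of maximal rank is not invertible, then averaging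
   provides a nonzero intertwiner from its kernel to a complement of its
   image. *)
have [r /asboolP[H HC rH] rmax] := ex_maxnP Q0 Qn.
exists H => //; rewrite -row_free_unit /row_free rH eqn_leq.
rewrite -[X in (X <= n)%N]rH rank_leq_row /= leqNgt; apply/negP => ltrn.
pose K := kermx H.
have KS a : (K *m rho1 a <= K)%MS.
  by apply/sub_kermxP; rewrite -mulmxA HC mulmxA mulmx_ker mul0mx.
pose p := average rho1 rho1 (pinvmx K *m K).
have pK : (p <= K)%MS by apply: average_submx => //; exact: submxMl.
have Kp : K *m p = K.
  by apply: average_fix => // a; rewrite mulmxA mulmxKpV.
have pH : p *m H = 0 by exact/sub_kermxP.
have K0 : K != 0 by rewrite kermx_eq0 /row_free rH neq_ltn ltrn.
have p0 : p != 0 by apply: contraNneq K0 => p0; rewrite -Kp p0 mulmx0.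
have HS a : (H *m rho2 a <= H)%MS by rewrite -HC submxMl.
pose t := average rho2 rho2 (pinvmx H *m H).
have tH : (t <= H)%MS by apply: average_submx => //; exact: submxMl.
have Ht : H *m t = H.
  by apply: average_fix => // a; rewrite mulmxA mulmxKpV.
pose q := 1%:M - t.
have Hq : H *m q = 0 by rewrite mulmxBr mulmx1 Ht subrr.
have q0 : q != 0.
  apply: contraTneq ltrn => /eqP; rewrite subr_eq0 => /eqP t1.
  by rewrite -leqNgt -rH -[X in (X <= _)%N](mxrank1 k) t1 mxrankS.
have tC a : rho2 a *m t = t *m rho2 a by exact: averageC.
have qC a : rho2 a *m q = q *m rho2 a.
  by rewrite mulmxBr mulmxBl mulmx1 mul1mx tC.
have pC a : rho1 a *m p = p *m rho1 a by exact: averageC.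
have [X Y0] := average_neq0 rep1 rep2 pC qC p0 q0.
set Y := average _ _ _ in Y0.
have YC a : rho1 a *m Y = Y *m rho2 a by exact: averageC.
have qq : q *m q = q.
  rewrite [in X in X *m _]/q mulmxBl mul1mx.
  by case/submxP: tH => D ->; rewrite -mulmxA Hq mulmx0 subr0.
have pp : p *m p = p.
  by case/submxP: pK => D E; rewrite [in X in X *m _]E -mulmxA Kp -E.
have pY : p *m Y = Y.
  rewrite /Y /average mulmx_sumr; apply: eq_bigr => x _.
  by rewrite !mulmxA -pC -[rho1 _ *m p *m p]mulmxA pp.
have Yq : Y *m q = Y.
  rewrite /Y /average mulmx_suml; apply: eq_bigr => x _.
  by rewrite -[LHS]mulmxA qC !mulmxA -[_ *m q *m q]mulmxA qq.
(* [p] kills [H] and fixes [Y], so [p *m H' = Y] and the row space of [H'] contains those of [Y] and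
   [H]. Were it only that of [H], then [Y = Y *m q] would vanish, because [H *m q = 0]. *)
pose H' : 'M[k]_n := H + Y.
have YH' : (Y <= H')%MS.
  by apply/submxP; exists p; rewrite mulmxDr pH add0r pY.
have HH' : (H <= H')%MS.
  by rewrite -[X in (X <= _)%MS](addrK Y) addmx_sub // eqmx_opp.
have : (\rank H' <= r)%N.
  apply: rmax; apply/asboolP; exists H' => // a.
  by rewrite mulmxDr mulmxDl HC YC.
rewrite leqNgt -rH; case/negP; apply: rank_ltmx; rewrite ltmxE HH' /=.
apply: contra Y0 => H'H; case/submxP: (submx_trans YH' H'H) => D YE.
by rewrite -Yq YE -mulmxA Hq mulmx0.
Qed.
End Representation.

(** * Localization at maximal ideals *)

Section MaximalIdeals.
Local Open Scope quotient_scope.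
Variable Z : comNzRingType.
Implicit Types (m : {pred Z}).

Lemma maximal_ideal_inv m x : maximal_ideal m -> x \notin m ->
  exists y, 1 - y * x \in m.
Proof.
move=> [[m0 m1 mP] mmax] xm.
pose J : {pred Z} := fun a => `[< exists y, a - y * x \in m >].
have mJ : {subset m <= J}.
  by move=> a am; apply/asboolP; exists 0; rewrite mul0r subr0.
case: (boolP (1 \in J)) => [/asboolP //|J1].
have /mmax/(_ mJ) JM : idealr_closed J.
  split=> [||a u v /asboolP[y uy] /asboolP[y' vy]] //.
    by apply: mJ.
  apply/asboolP; exists (a * y + y').
  have -> : a * u + v - (a * y + y') * x = a * (u - y * x) + (v - y' * x).
    by rewrite mulrDl mulrBr opprD addrACA mulrA.
  exact: mP.
by case/negP: xm; apply: JM; apply/asboolP; exists 1; rewrite mul1r subrr.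
Qed.

Lemma residue_field m : maximal_ideal m ->
  exists (k : fieldType) (chi : {rmorphism Z -> k}),
    (forall t, exists z, chi z = t) /\ forall z, (z \in m) = (chi z == 0).
Proof.
move=> mmax; have mI := mmax.1.
pose I : idealr Z := HB.pack m (isIdealr.Build Z m mI).
pose Q := {ideal_quot I}.
have piE (z : Z) : (\pi_Q z == 0 :> Q) = (z \in m).
  by rewrite piE Quotient.equivE subr0.
have inv_ex (x : Q) : exists y : Q, (x != 0 -> y * x = 1) /\ (x = 0 -> y = 0).
  have [->|x0] := eqVneq x 0; first by exists 0.
  have xm : repr x \notin m by rewrite -piE reprK.
  have [y ym] := maximal_ideal_inv mmax xm.
  exists (\pi_Q y); split=> [_|/eqP]; last by rewrite (negPf x0).
  apply/eqP; rewrite eq_sym -subr_eq0 -[x]reprK.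
  have -> : 1 - \pi_Q y * \pi_Q (repr x) = \pi_Q (1 - y * repr x) :> Q.
    by rewrite rmorphB rmorphM rmorph1.
  by rewrite piE.
have [inv invP] := choice inv_ex.
pose F : fieldType := HB.pack Q
  (GRing.ComNzRing_isField.Build Q (fun x => (invP x).1) ((invP 0).2 erefl)).
exists F, (\pi_Q : {rmorphism Z -> Q}); split=> [t|z]; last by rewrite -piE.
by exists (repr (t : Q)); exact: (reprK (t : Q)).
Qed.

Lemma maximal_ideal_prime m : maximal_ideal m ->
  exists p : prime_idealr Z, forall z, (z \in p) = (z \in m).
Proof.
move=> mmax; have [k [chi [_ chiE]]] := residue_field mmax.
have mprime : prime_idealr_closed m.
  by move=> u v; rewrite !chiE rmorphM mulf_eq0.
pose p : prime_idealr Z := HB.pack m (isIdealr.Build Z m mmax.1)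
  (isPrimeIdealrClosed.Build Z m mprime).
by exists p.
Qed.

Lemma maximal_ideal_exists (I : {pred Z}) : idealr_closed I ->
  exists2 m, maximal_ideal m & {subset I <= m}.
Proof.
move=> idI; pose T := {J : Z -> bool | idealr_closed J /\ {subset I <= J}}.
pose le (s t : T) := `[< {subset sval s <= sval t} >].
have t0 : T by exists I; split.
have [||C Ctot|[m [mI Im]] mmax] := @ZL_preorder T t0 le.
- by move=> s; apply/asboolP.
- by move=> b a c /asboolP ab /asboolP bc; apply/asboolP => x /ab /bc.
- have [C0|/existsNP[s0 /contrapT Cs0]] := pselect (forall s, ~ C s).
    by exists t0 => s /C0.
  pose U : {pred Z} := fun x => `[< exists2 s : T, C s & x \in sval s >].
  have UI : idealr_closed U.
    split=> [||a u v /asboolP[s Cs us] /asboolP[t Ct vt]].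
    - by apply/asboolP; exists s0 => //; case: (svalP s0) => -[].
    - by apply/asboolP => -[s _]; apply/negP; case: (svalP s) => -[].
    have [/asboolP st|/asboolP ts] := Ctot s t Cs Ct.
      apply/asboolP; exists t => //; case: (svalP t) => -[_ _ tP] _.
      by apply: tP => //; apply: st.
    apply/asboolP; exists s => //; case: (svalP s) => -[_ _ sP] _.
    by apply: sP => //; apply: ts.
  have IU : {subset I <= U}.
    by move=> x xI; apply/asboolP; exists s0 => //; apply: (svalP s0).2.
  exists (exist _ U (conj UI IU)) => s Cs; apply/asboolP => x xs.
  by apply/asboolP; exists s.
exists m => //; split=> // J JI mJ x xJ.
have IJ : {subset I <= J} by move=> y /Im /mJ.
have /asboolP := mmax (exist _ J (conj JI IJ)) (introT (asboolP _) mJ).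
exact.
Qed.
End MaximalIdeals.

(** * Reduction of modules modulo a maximal ideal, and Nakayama's lemma *)

Section IdealMul.
Variables (Z : comNzRingType) (m : {pred Z}).

(** Membership in the submodule [mM]; a predicate on [M] takes the place of the quotient
    [M / mM]. *)
Definition ideal_mul (M : lmodType Z) (v : M) : Prop :=
  exists2 s : seq (Z * M), {in s, forall q, q.1 \in m} &
    v = \sum_(q <- s) q.1 *: q.2.

Variable M : lmodType Z.
Implicit Types u v : M.

Lemma ideal_mul0 : ideal_mul (0 : M).
Proof. by exists [::]; rewrite ?big_nil. Qed.

Lemma ideal_mulD u v : ideal_mul u -> ideal_mul v -> ideal_mul (u + v).
Proof.
move=> [s sm ->] [t tm ->]; exists (s ++ t); last by rewrite big_cat.
by move=> q; rewrite mem_cat => /orP[/sm|/tm].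
Qed.

Lemma ideal_mulZ z v : ideal_mul v -> ideal_mul (z *: v).
Proof.
move=> [s sm ->]; exists [seq (q.1, z *: q.2) | q <- s].
  by move=> _ /mapP[q /sm qm ->].
rewrite big_map scaler_sumr; apply: eq_bigr => q _.
by rewrite !scalerA mulrC.
Qed.

Lemma ideal_mulB u v : ideal_mul u -> ideal_mul v -> ideal_mul (u - v).
Proof. by move=> um vm; rewrite -scaleN1r; apply/ideal_mulD/ideal_mulZ. Qed.

Lemma ideal_mul_scale z v : z \in m -> ideal_mul (z *: v).
Proof.
by move=> zm; exists [:: (z, v)]; rewrite ?big_seq1 // => q /[!inE] /eqP ->.
Qed.

Lemma ideal_mul_sum I (r : seq I) (F : I -> M) :
  (forall i, ideal_mul (F i)) -> ideal_mul (\sum_(i <- r) F i).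
Proof.
by move=> FP; apply: big_ind => //; [exact: ideal_mul0|exact: ideal_mulD].
Qed.

Lemma ideal_mul_linear (N : lmodType Z) (g : {linear M -> N}) v :
  ideal_mul v -> ideal_mul (g v).
Proof.
move=> [s sm ->]; exists [seq (q.1, g q.2) | q <- s].
  by move=> _ /mapP[q /sm qm ->].
by rewrite linear_sum big_map; apply: eq_bigr => q _; rewrite linearZ.
Qed.

Lemma ideal_mul_gen n (u : 'I_n -> M) v : idealr_closed m ->
  (forall w, exists c : 'I_n -> Z, w = \sum_i c i *: u i) ->
  ideal_mul v -> exists2 c : 'I_n -> Z, (forall i, c i \in m) &
    v = \sum_i c i *: u i.
Proof.
move=> [m0 _ mP] gen [s sm ->]; elim: s sm => [|q s IHs] sm.
  exists (fun=> 0) => //; rewrite big_nil big1 // => i _; exact: scale0r.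
have [|c cm E] := IHs; first by move=> t ts; apply: sm; rewrite inE ts orbT.
have [d dE] := gen q.2; exists (fun i => d i * q.1 + c i) => [i|].
  by apply: mP => //; apply: sm; rewrite inE eqxx.
rewrite big_cons E [in LHS]dE scaler_sumr -big_split; apply: eq_bigr => i _ /=.
by rewrite scalerDl scalerA mulrC.
Qed.
End IdealMul.

Section Residue.
Variables (Z : comNzRingType) (m : {pred Z}) (k : fieldType).
Variable chi : {rmorphism Z -> k}.
Hypothesis chi_surj : forall t, exists z, chi z = t.
Hypothesis chi_ker : forall z, (z \in m) = (chi z == 0).

Lemma ker_idealr_closed : idealr_closed m.
Proof.
split=> [||a u v]; rewrite !chi_ker ?rmorph0 ?rmorph1 ?eqxx ?oner_eq0 //.
by move=> /eqP u0 /eqP v0; rewrite rmorphD rmorphM u0 v0 mulr0 addr0.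
Qed.

Record reduction (M : lmodType Z) n (kappa : M -> 'rV[k]_n) : Prop :=
  Reduction {
    red_linear : forall z u v, kappa (z *: u + v) = chi z *: kappa u + kappa v;
    red_surj : forall t, exists v, kappa v = t;
    red_ker : forall v, kappa v = 0 -> ideal_mul m v
  }.

Section ReductionTheory.
Variables (M : lmodType Z) (n : nat) (kappa : M -> 'rV[k]_n).
Hypothesis kappaP : reduction kappa.

Lemma redD u v : kappa (u + v) = kappa u + kappa v.
Proof. by rewrite -[u]scale1r (red_linear kappaP) rmorph1 !scale1r. Qed.

Lemma red0 : kappa 0 = 0.
Proof. by apply: (addrI (kappa 0)); rewrite -redD !addr0. Qed.

Lemma redZ z v : kappa (z *: v) = chi z *: kappa v.
Proof. by rewrite -[z *: v]addr0 (red_linear kappaP) red0 addr0. Qed.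

Lemma red_sum I (r : seq I) (F : I -> M) :
  kappa (\sum_(i <- r) F i) = \sum_(i <- r) kappa (F i).
Proof. exact: (big_morph kappa redD red0). Qed.

Lemma red_ideal_mul v : ideal_mul m v -> kappa v = 0.
Proof.
move=> [s sm ->]; rewrite red_sum big1_seq // => q /= /sm.
by rewrite redZ chi_ker => /eqP ->; rewrite scale0r.
Qed.

Lemma redB u v : kappa (u - v) = kappa u - kappa v.
Proof. by rewrite redD -scaleN1r redZ rmorphN1 scaleN1r. Qed.
End ReductionTheory.

Lemma reduction_exists (M : lmodType Z) : finitely_generated M ->
  exists n (kappa : M -> 'rV[k]_n), reduction kappa.
Proof.
move=> [N [u uP]].
have mI := ker_idealr_closed.
pose lc (c : 'I_N -> Z) := \sum_i c i *: u i.
pose bar (c : 'I_N -> Z) : 'rV[k]_N := \row_i chi (c i).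
have lcP z c d : lc (fun i => z * c i + d i) = z *: lc c + lc d.
  rewrite /lc scaler_sumr -big_split; apply: eq_bigr => i _ /=.
  by rewrite scalerDl scalerA.
have barP z c d : bar (fun i => z * c i + d i) = chi z *: bar c + bar d.
  by apply/rowP => i; rewrite !mxE rmorphD rmorphM.
pose S (t : 'rV[k]_N) := exists2 c, t = bar c & ideal_mul m (lc c).
have [|z c d [c' -> cm] [d' -> dm]|W WP] := @subspace_row_space k _ S.
- exists (fun=> 0); first by apply/rowP => i; rewrite !mxE rmorph0.
  by rewrite /lc big1 => [|i _]; [exact: ideal_mul0|exact: scale0r].
- have [y <-] := chi_surj z; exists (fun i => y * c' i + d' i) => //.
  by rewrite lcP; apply/ideal_mulD/dm/ideal_mulZ.
have WE c : (bar c <= W)%MS <-> ideal_mul m (lc c).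
  split=> [/WP[d bd dm]|cm]; last by apply/WP; exists c.
  have -> : lc c = lc d + lc (fun i => c i - d i).
    rewrite /lc -big_split; apply: eq_bigr => i _ /=.
    by rewrite -scalerDl addrC subrK.
  apply: ideal_mulD => //; apply: ideal_mul_sum => i; apply: ideal_mul_scale.
  have := congr1 (fun t : 'rV_N => t 0 i) bd; rewrite !mxE => cd.
  by rewrite chi_ker rmorphB cd subrr.
have [co coP] := choice uP.
(* [cokermx W] has the right kernel but need not be onto; its column base has the same kernel and is
   onto. *)
pose C := col_base (cokermx W).
have CE (t : 'rV_N) : (t *m C == 0) = (t <= W)%MS.
  rewrite -(mulmx_free_eq0 _ (row_base_free (cokermx W))).
  by rewrite -mulmxA mulmx_base submxE.
exists (\rank (cokermx W)), (fun v => bar (co v) *m C); split.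
- move=> z v w; rewrite scalemxAl -mulmxDl -barP; apply/eqP.
  rewrite -subr_eq0 -mulmxBl; set d := fun i => _.
  have -> : bar (co (z *: v + w)) - bar d =
      bar (fun i => co (z *: v + w) i - d i).
    by apply/rowP => i; rewrite !mxE rmorphB.
  rewrite CE; apply/WE.
  have -> : lc (fun i => co (z *: v + w) i - d i) = lc (co (z *: v + w)) - lc d.
    by rewrite /lc -sumrB; apply: eq_bigr => i _; rewrite scalerBl.
  rewrite lcP /lc -!coP subrr; exact: ideal_mul0.
- move=> t.
  have /submxP[s ->] : (t <= C)%MS by apply: submx_full; exact: col_base_full.
  have [zeta zetaP] := choice chi_surj.
  exists (lc (fun i => zeta (s 0 i))); apply/eqP.
  rewrite -subr_eq0 -mulmxBl; set w := lc _; set d := fun i => zeta (s 0 i).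
  have -> : bar (co w) - s = bar (fun i => co w i - d i).
    by apply/rowP => i; rewrite !mxE rmorphB zetaP.
  rewrite CE; apply/WE.
  have -> : lc (fun i => co w i - d i) = lc (co w) - lc d.
    by rewrite /lc -sumrB; apply: eq_bigr => i _; rewrite scalerBl.
  rewrite {1}/lc -coP subrr; exact: ideal_mul0.
- by move=> v /eqP; rewrite CE => /WE; rewrite /lc -coP.
Qed.

(** If [s *: v] has coefficients [c_i] with [s] outside [m], then [kappa v] has coordinates
    [chi (c_i) / chi s], and linear independence makes them well defined. The length of a localized
    basis is thus the dimension of [M / mM]. *)
Lemma localized_basis_reduction (M : lmodType Z) (p : prime_idealr Z) n
    (x : 'I_n -> M) :
  (forall z, (z \in p) = (z \in m)) -> localized_basis p x ->
  exists kappa : M -> 'rV[k]_n, reduction kappa.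
Proof.
move=> pm [span indep].
have pE z : (z \in p) = (chi z == 0) by rewrite pm chi_ker.
pose rel v (t : 'rV[k]_n) := exists s (c : 'I_n -> Z),
  [/\ chi s != 0, s *: v = \sum_i c i *: x i
    & forall i, chi s * t 0 i = chi (c i)].
have rel_ex v : exists t, rel v t.
  have [s [c [sp sv]]] := span v.
  have s0 : chi s != 0 by rewrite -pE.
  exists (\row_i ((chi s)^-1 * chi (c i))), s, c; split=> // i.
  by rewrite mxE mulVKf.
have rel_lin z u v t t' : rel u t -> rel v t' ->
    rel (z *: u + v) (chi z *: t + t').
  move=> [s [c [s0 su ct]]] [s' [c' [s0' sv ct']]].
  exists (s * s'), (fun i => s' * z * c i + s * c' i); split.
  - by rewrite rmorphM mulf_neq0.
  - transitivity ((s' * z) *: (s *: u) + s *: (s' *: v)).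
      by rewrite scalerDr !scalerA; congr (_ *: _ + _); ring.
    rewrite su sv !scaler_sumr -big_split; apply: eq_bigr => i _ /=.
    by rewrite scalerDl !scalerA.
  - by move=> i; rewrite !mxE rmorphD !rmorphM -ct -ct'; ring.
have rel_uniq v t t' : rel v t -> rel v t' -> t = t'.
  move=> [s [c [s0 su ct]]] [s' [c' [s0' sv ct']]]; apply/rowP => i.
  have [|r rp] := indep (fun i => s' * c i - s * c' i) _ i.
    transitivity (s' *: (s *: v) - s *: (s' *: v)); last first.
      by rewrite !scalerA mulrC subrr.
    rewrite su sv !scaler_sumr -sumrB; apply: eq_bigr => j _.
    by rewrite scalerBl !scalerA.
  move/(congr1 chi); rewrite rmorph0 rmorphM => /eqP; rewrite mulf_eq0.
  rewrite -pE (negPf rp) /= rmorphB !rmorphM subr_eq0 -ct -ct' mulrCA.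
  by move=> /eqP/(mulfI s0)/(mulfI s0').
have [kappa kappaP] := choice rel_ex; exists kappa; split.
- move=> z u v; apply: rel_uniq (kappaP _) _; exact: rel_lin.
- move=> t; have [zeta zetaP] := choice chi_surj.
  exists (\sum_i zeta (t 0 i) *: x i); apply: rel_uniq (kappaP _) _.
  exists 1, (fun i => zeta (t 0 i)).
  rewrite rmorph1 scale1r oner_eq0; split=> // i.
  by rewrite mul1r zetaP.
- move=> v v0; have := kappaP v; rewrite v0 => -[s [c [s0 sv ct]]].
  have [y ys] := chi_surj (chi s)^-1.
  have -> : v = (1 - y * s) *: v + y *: (s *: v).
    by rewrite scalerBl scale1r scalerA subrK.
  apply: ideal_mulD.
    apply: ideal_mul_scale.
    by rewrite chi_ker rmorphB rmorphM ys mulVf // rmorph1 subrr.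
  rewrite sv; apply: ideal_mulZ; apply: ideal_mul_sum => i.
  by apply: ideal_mul_scale; rewrite chi_ker -ct mxE mulr0.
Qed.

(** Modulo [N], each [u_j] is a combination of the [u_l] with coefficients [mu] in [m], so
    [B = 1 - mu] sends the family [u] into [N]. The adjugate of [B] then puts [\det B *: u_j] in
    [N], and [\det B] is 1 modulo [m]. *)
Lemma determinant_trick (M : lmodType Z) (N : M -> Prop) n (u : 'I_n -> M) :
  N 0 -> (forall z v w, N v -> N w -> N (z *: v + w)) ->
  (forall v, exists c : 'I_n -> Z, v = \sum_i c i *: u i) ->
  (forall j, exists2 w, N w & ideal_mul m (u j - w)) ->
  exists2 s, s \notin m & forall j, N (s *: u j).
Proof.
move=> N0 NP gen uN.
have /choice[mu muP] : forall j, exists c : 'I_n -> Z,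
    (forall i, c i \in m) /\ N (u j - \sum_i c i *: u i).
  move=> j; have [w Nw] := uN j.
  case/(ideal_mul_gen ker_idealr_closed gen) => c cm E; exists c; split=> //.
  by rewrite -E opprB addrC subrK.
pose B : 'M[Z]_n := 1%:M - \matrix_(j, l) mu j l.
have Bu j : N (\sum_l B j l *: u l).
  have [_] := muP j; congr N; under [RHS]eq_bigr do rewrite !mxE scalerBl.
  rewrite sumrB; congr (_ - _).
  rewrite (bigD1 j) //= eqxx scale1r big1 ?addr0 //.
  by move=> l; rewrite eq_sym => /negPf ->; rewrite scale0r.
exists (\det B).
  rewrite chi_ker -det_map_mx; have -> : map_mx chi B = 1%:M.
    apply/matrixP => i j; rewrite !mxE rmorphB rmorph_nat.
    by have [/(_ j)] := muP i; rewrite chi_ker => /eqP -> _; rewrite subr0.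
  by rewrite det1 oner_eq0.
move=> i.
have -> : \det B *: u i = \sum_j (\adj B) i j *: (\sum_l B j l *: u l).
  under [RHS]eq_bigr do rewrite scaler_sumr.
  rewrite exchange_big /=.
  transitivity (\sum_l (\det B)%:M i l *: u l).
    rewrite (bigD1 i) //= mxE eqxx big1 ?addr0 // => l; rewrite eq_sym mxE.
    by move=> /negPf ->; rewrite scale0r.
  apply: eq_bigr => l _; rewrite -mul_adj_mx mxE scaler_suml.
  by apply: eq_bigr => j _; rewrite scalerA.
have ND v w : N v -> N w -> N (v + w).
  by move=> Nv Nw; rewrite -[v]scale1r; apply: NP.
apply: (big_ind N) => // j _; rewrite -[_ *: _]addr0; exact: NP.
Qed.

(** Lifts [x] of a basis of [M / mM] span locally by the determinant trick. Independence comes from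
    forms [phi_i] with [phi_i (x_j)] congruent to the Kronecker delta, whose matrix [G] has
    determinant outside [m]; the last hypothesis supplies such forms. *)
Lemma reduction_localized_basis (M : lmodType Z) (p : prime_idealr Z) n
    (kappa : M -> 'rV[k]_n) :
  (forall z, (z \in p) = (z \in m)) ->
  finitely_generated M -> reduction kappa ->
  (forall v, (forall phi : {linear M -> Z^o}, phi v \in m) -> ideal_mul m v) ->
  exists x : 'I_n -> M, localized_basis p x.
Proof.
move=> pm [N [u gen]] kappaP enough.
have [b bP] := choice (red_surj kappaP).
pose x i := b (delta_mx 0 i).
have xP i : kappa (x i) = delta_mx 0 i by rewrite /x bP.
have [zeta zetaP] := choice chi_surj.
have vE v : ideal_mul m (v - \sum_i zeta (kappa v 0 i) *: x i).
  apply: (red_ker kappaP); rewrite (redB kappaP) (red_sum kappaP).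
  apply/eqP; rewrite subr_eq0; apply/eqP.
  rewrite [LHS]row_sum_delta; apply: eq_bigr => i _.
  by rewrite (redZ kappaP) zetaP xP.
pose S (t : 'rV[k]_n) :=
  exists phi : {linear M -> Z^o}, t = \row_i chi (phi (x i)).
have [|c t t' [phi ->] [phi' ->]|W WP] := @subspace_row_space k _ S.
- by exists \0; apply/rowP => i; rewrite !mxE rmorph0.
- have [z <-] := chi_surj c; exists (z \*: phi \+ phi')%R.
  by apply/rowP => i; rewrite !mxE rmorphD rmorphM.
(* A nonzero column of [cokermx W] would give the residual coordinates of some [v] on which all
   forms vanish modulo [m]; but such a [v] lies in [mM]. *)
have Wfull : row_full W.
  rewrite -cokermx_eq0; apply: contrapT.
  have WK (t : 'rV_n) : (t <= W)%MS -> t *m cokermx W = 0.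
    by rewrite submxE => /eqP.
  move: (cokermx W) WK => K WK /negP/matrix0Pn[i [j Kij]].
  pose v := \sum_l zeta (K l j) *: x l.
  have : forall phi : {linear M -> Z^o}, phi v \in m.
    move=> phi; have : (\row_l chi (phi (x l)) <= W)%MS by apply/WP; exists phi.
    move=> /WK/matrixP/(_ 0 j); rewrite !mxE => H.
    rewrite chi_ker linear_sum rmorph_sum -[X in _ == X]H; apply/eqP.
    apply: eq_bigr => l _; rewrite linearZ [LHS]rmorphM zetaP mulrC.
    by congr (_ * _); apply: esym; exact: mxE.
  move/enough/(red_ideal_mul kappaP).
  rewrite (red_sum kappaP) => /rowP/(_ i); rewrite summxE (bigD1 i) //= big1.
    rewrite (redZ kappaP) xP zetaP !mxE !eqxx mulr1 addr0 => W0.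
    by rewrite W0 eqxx in Kij.
  move=> l li; rewrite (redZ kappaP) xP !mxE eqxx /=.
  by rewrite eq_sym (negPf li) mulr0.
have /choice[phi phiP] : forall i, exists phi : {linear M -> Z^o},
    delta_mx 0 i = \row_j chi (phi (x j)).
  by move=> i; apply/WP; exact: submx_full.
have phix i j : chi (phi i (x j)) = (i == j)%:R.
  by have /rowP/(_ j) := phiP i; rewrite !mxE eqxx /= eq_sym => <-.
exists x; split.
  have [|z v w [c ->] [d ->]|j|s sm su] :=
    @determinant_trick M (fun v => exists c, v = \sum_i c i *: x i) _ u _ _ gen.
  - by exists (fun=> 0); rewrite big1 // => i _; exact: scale0r.
  - exists (fun i => z * c i + d i); rewrite scaler_sumr -big_split.
    by apply: eq_bigr => i _ /=; rewrite scalerDl scalerA.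
  - exists (\sum_i zeta (kappa (u j) 0 i) *: x i) => //.
    by exists (fun i => zeta (kappa (u j) 0 i)).
  move=> v; have [d ->] := gen v; have [c cP] := choice su.
  exists s, (fun i => \sum_j d j * c j i); rewrite pm; split=> //.
  under [RHS]eq_bigr do rewrite scaler_suml.
  rewrite exchange_big scaler_sumr; apply: eq_bigr => j _ /=.
  rewrite scalerA mulrC -scalerA cP scaler_sumr.
  by apply: eq_bigr => i _; rewrite scalerA.
move=> c c0 i; pose G : 'M[Z]_n := \matrix_(i, j) phi i (x j).
exists (\det G).
  rewrite pm chi_ker -det_map_mx; have -> : map_mx chi G = 1%:M.
    by apply/matrixP => a b'; rewrite !mxE phix.
  by rewrite det1 oner_eq0.
have : \adj G *m (G *m \col_j c j) = 0.
  have -> : G *m \col_j c j = 0; last by rewrite mulmx0.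
  apply/colP => a; rewrite !mxE -[RHS](linear0 (phi a)) -c0 linear_sum.
  by apply: eq_bigr => j _; rewrite linearZ !mxE mulrC.
rewrite mulmxA mul_adj_mx mul_scalar_mx => /colP/(_ i).
by rewrite !mxE.
Qed.
End Residue.

(** The ideal [I] of all [z] with [z *: u_j] in [N] for every [j] lies in no maximal ideal [m],
    since [determinant_trick] produces an element of [I] outside [m]. Hence it contains 1. *)
Lemma nakayama (Z : comNzRingType) (M : lmodType Z) (N : M -> Prop) :
  finitely_generated M -> N 0 ->
  (forall z v w, N v -> N w -> N (z *: v + w)) ->
  (forall m : {pred Z}, maximal_ideal m ->
     forall v, exists2 w, N w & ideal_mul m (v - w)) ->
  forall v, N v.
Proof.
move=> [n [u gen]] N0 NP loc.
have NZ z v : N v -> N (z *: v) by rewrite -[z *: v]addr0 => ?; apply: NP.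
have Nsum (F : 'I_n -> M) : (forall i, N (F i)) -> N (\sum_i F i).
  move=> FN; apply: (big_ind N) => // v w Nv Nw.
  by rewrite -[v]scale1r; apply: NP.
pose I : {pred Z} := fun z => `[< forall j, N (z *: u j) >].
case: (boolP (1 \in I)) => [/asboolP N1 v|I1].
  have [c ->] := gen v; apply: Nsum => i; apply: NZ.
  by rewrite -[u i]scale1r.
have II : idealr_closed I.
  split=> // [|a z z' /asboolP zN /asboolP zN'].
    by apply/asboolP => j; rewrite scale0r.
  by apply/asboolP => j; rewrite scalerDl -scalerA; apply: NP.
have [m mmax Im] := maximal_ideal_exists II.
have [k [chi [chi_surj chi_ker]]] := residue_field mmax.
have [s sm sN] :=
  determinant_trick chi_ker N0 NP gen (fun j => loc m mmax (u j)).
by case/negP: sm; apply: Im; apply/asboolP.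
Qed.

(** * Modules over a central separable algebra *)

Lemma finitely_generated_fin (S : nzRingType) (M : lmodType S) (I : finType)
    (x : I -> M) :
  (forall v, exists c : I -> S, v = \sum_i c i *: x i) -> finitely_generated M.
Proof.
move=> gen; exists #|I|, (fun i => x (enum_val i)) => v.
have [c ->] := gen v; exists (fun i => c (enum_val i)).
by rewrite (reindex_onto enum_val enum_rank) //= => [|i _]; 
  [apply: eq_bigl => i; rewrite enum_valK eqxx | exact: enum_rankK].
Qed.

Section RightModules.
Variable A : nzRingType.

Lemma rscaleA (M : rmodType A) (v : M) a b :
  rscale (rscale v a) b = rscale v (a * b).
Proof. by rewrite /rscale scalerA. Qed.

Lemma rscaleDl (M : rmodType A) (u v : M) a :
  rscale (u + v) a = rscale u a + rscale v a.
Proof. exact: scalerDr. Qed.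

Lemma rscaleDr (M : rmodType A) (v : M) a b :
  rscale v (a + b) = rscale v a + rscale v b.
Proof. exact: scalerDl. Qed.

Lemma rscale1 (M : rmodType A) (v : M) : rscale v 1 = v.
Proof. exact: scale1r. Qed.

Lemma rscale_lin (M N : rmodType A) (h : {linear M -> N}) v a :
  h (rscale v a) = rscale (h v) a.
Proof. exact: linearZ. Qed.

Lemma over_centerE (M : rmodType A) (z : center A) (v : over_center M) :
  z *: v = rscale (v : M) (val z).
Proof. by []. Qed.

Section LinearOverCenter.
Variables (M N : rmodType A) (h : {linear M -> N}).

Definition center_map (v : over_center M) : over_center N := h v.

Lemma center_map_linear : linear center_map.
Proof. by move=> z u v; rewrite /center_map [LHS]linearP. Qed.

HB.instance Definition _ := GRing.isLinear.Build (center A) (over_center M)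
  (over_center N) *:%R center_map center_map_linear.
End LinearOverCenter.

Section ScaleOverCenter.
Variables (M : rmodType A) (a : A).

Definition center_scale (v : over_center M) : over_center M := rscale (v : M) a.

Lemma center_scale_linear : linear center_scale.
Proof.
move=> z u v; rewrite /center_scale over_centerE rscaleDl.
congr (_ + _); rewrite over_centerE !rscaleA.
by have /centralP -> := valP z.
Qed.

HB.instance Definition _ := GRing.isLinear.Build (center A) (over_center M)
  (over_center M) *:%R center_scale center_scale_linear.
End ScaleOverCenter.

(** With [psi] the coordinates of a dual basis [u], this replaces [u_i] by [y_i] in the expansion of
    [v]. The [u_i] may satisfy relations, so [h (u_i) = y_i] can fail; but any morphism sending each
    [y_i] to [u_i] has [h] as a section. *)
Lemma dual_lift (M N : rmodType A) n (psi : 'I_n -> {linear M -> (A^c)^o})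
    (y : 'I_n -> N) :
  exists h : {linear M -> N}, forall v, h v = \sum_i rscale (y i) (psi i v : A).
Proof.
pose hf v := \sum_i rscale (y i) (psi i v : A).
have hlin : linear hf.
  move=> c u v; rewrite /hf scaler_sumr -big_split; apply: eq_bigr => i _ /=.
  by rewrite linearP rscaleDr; congr (_ + _); rewrite /rscale scalerA.
pose h : {linear M -> N} := HB.pack hf (GRing.isLinear.Build _ _ _ _ hf hlin).
by exists h.
Qed.

Lemma regular_dual_basis : dual_basis ((A^c)^o : rmodType A).
Proof.
exists 1%N, (fun=> 1), (fun=> idfun) => v.
by rewrite big_ord1 [RHS]mulr1.
Qed.
Definition residual_iso (m : {pred center A}) (M N : rmodType A) (h : M -> N) :=
  (forall y, exists x, ideal_mul m (y - h x : over_center N)) /\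
  (forall v, ideal_mul m (h v : over_center N) ->
     ideal_mul m (v : over_center M)).

End RightModules.

Section ScalarCenter.
Variables (R : comNzRingType) (A : algType R).

Definition scalar_center (r : R) : center A := Sub r%:A (scalar_in_center A r).

Lemma scalar_center_zmod_morphism : zmod_morphism scalar_center.
Proof. by move=> r t; apply: val_inj; rewrite /= scalerBl. Qed.

Lemma scalar_center_monoid_morphism : monoid_morphism scalar_center.
Proof.
split=> [|r t]; apply: val_inj; first by rewrite /= scale1r.
by rewrite /= mulr_algl scalerA.
Qed.

HB.instance Definition _ := GRing.isZmodMorphism.Build R (center A)
  scalar_center scalar_center_zmod_morphism.
HB.instance Definition _ := GRing.isMonoidMorphism.Build R (center A)
  scalar_center scalar_center_monoid_morphism.
End ScalarCenter.

Section CentralSeparable.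
Variables (R : comNzRingType) (A : algType R).
Variable s : seq (A * {linear A -> R^o}).
Hypothesis s_dual : forall a, a = \sum_(q <- s) (q.2 a : R) *: q.1.
Variable e : seq (A * A).
Hypothesis sep_e : separability_family e.


Lemma dual_basis_fg (M : rmodType A) :
  dual_basis M -> finitely_generated (over_center M).
Proof.
move=> [n [u [psi uP]]].
pose x (ij : 'I_n * 'I_(size s)) : over_center M :=
  rscale (u ij.1) (tnth (in_tuple s) ij.2).1.
apply: (@finitely_generated_fin _ _ _ x) => v.
exists (fun ij => scalar_center A ((tnth (in_tuple s) ij.2).2 (psi ij.1 v))).
rewrite -(pair_bigA _ (fun i j =>
  scalar_center A ((tnth (in_tuple s) j).2 (psi i v)) *: x (i, j))) /=.
rewrite [LHS]uP; apply: eq_bigr => i _.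
rewrite [X in X *: _](s_dual (psi i v)) (big_tnth _ _ s) scaler_suml.
by apply: eq_bigr => j _; rewrite over_centerE rscaleA /= mulr_algr.
Qed.

Section TraceFunctional.
Variables (M : rmodType A) (psi : {linear M -> (A^c)^o}) (c d : A).

(** The factors [c] and [d] make the elements of [A] whose values all lie in [m] a two-sided ideal,
    so that [ideal_central_unit] applies to it. *)
Definition trace_functional (v : over_center M) : (center A)^o :=
  trace sep_e (c * (psi v : A) * d).

Lemma trace_functional_linear : linear trace_functional.
Proof.
move=> z u v; rewrite /trace_functional linearP; apply: val_inj => /=.
rewrite /trace_val mulr_sumr -big_split; apply: eq_bigr => q _ /=.
have /centralP zC := valP z.
change (q.1 * (c * ((psi u : A) * sval z + psi v) * d) * q.2 =
  sval z * (q.1 * (c * psi u * d) * q.2) + q.1 * (c * psi v * d) * q.2).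
rewrite -(zC (psi u)) mulrDr !mulrDl mulrDr mulrDl; congr (_ + _).
have zCA x y : x * (sval z * y) = sval z * (x * y) by rewrite !mulrA zC.
by rewrite -!mulrA !(zCA c) (zCA q.1).
Qed.

HB.instance Definition _ := GRing.isLinear.Build (center A) (over_center M)
  (center A)^o *:%R trace_functional trace_functional_linear.
End TraceFunctional.

Section Local.
Variables (m : {pred center A}) (k : fieldType).
Variable chi : {rmorphism center A -> k}.
Hypothesis chi_surj : forall t, exists z, chi z = t.
Hypothesis chi_ker : forall z, (z \in m) = (chi z == 0).

Lemma reduction_representation (M : rmodType A) n
    (kappa : over_center M -> 'rV[k]_n) : reduction m chi kappa ->
  exists2 rho, representation chi rho &
    forall v a, kappa (rscale (v : M) a) = kappa v *m rho a.
Proof.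
move=> kappaP; have [b0 bP] := choice (red_surj kappaP).
pose b i := b0 (delta_mx 0 i).
have kb i : kappa (b i) = delta_mx 0 i by rewrite /b bP.
pose rho a : 'M[k]_n := \matrix_(i < n) kappa (rscale (b i : M) a).
have [zeta zetaP] := choice chi_surj.
have kM (v : over_center M) a : kappa (rscale (v : M) a) = kappa v *m rho a.
  pose w : over_center M := \sum_i zeta (kappa v 0 i) *: b i.
  have vw : ideal_mul m (v - w).
    apply: (red_ker kappaP); rewrite (redB kappaP) (red_sum kappaP).
    apply/eqP; rewrite subr_eq0; apply/eqP; rewrite [LHS]row_sum_delta.
    by apply: eq_bigr => i _; rewrite (redZ kappaP) zetaP kb.
  have := red_ideal_mul chi_ker kappaP (ideal_mul_linear (center_scale a) vw).
  rewrite linearB (redB kappaP) => /eqP; rewrite subr_eq0 => /eqP ->.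
  rewrite linear_sum (red_sum kappaP) mulmx_sum_row; apply: eq_bigr => i _.
  by rewrite linearZ (redZ kappaP) zetaP rowK.
exists rho => //; split=> [a a'|a a'|z]; apply/row_matrixP => i.
- by rewrite rowK [RHS]linearD /= !rowK rscaleDr (redD kappaP).
- by rewrite row_mul !rowK -kM rscaleA.
- rewrite rowK -over_centerE (redZ kappaP) kb.
  by rewrite rowE mul_mx_scalar.
Qed.

(** The elements in question form a two-sided ideal, to which [ideal_central_unit] attaches a
    central element [z]. Since [trace] fixes [z], the case [c = d = 1] gives [chi z = 0]; so the
    ideal acts as zero on [A / mA], and [a = 1 a] lies in [mA]. *)
Lemma trace_nondegenerate (a : A) :
  (forall c d, trace sep_e (c * a * d) \in m) ->
  ideal_mul m (a : over_center ((A^c)^o : rmodType A)).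
Proof.
move=> am; have fgA := dual_basis_fg (regular_dual_basis A).
have [n [kappa kappaP]] := reduction_exists chi_surj chi_ker fgA.
have [rho rep kM] := reduction_representation kappaP.
pose I (x : A) := forall c d, trace sep_e (c * x * d) \in m.
have traceD x y : trace sep_e (x + y) = trace sep_e x + trace sep_e y.
  apply: val_inj; rewrite /= /trace_val -big_split; apply: eq_bigr => q _ /=.
  by rewrite mulrDr mulrDl.
have trace0 : trace sep_e 0 = 0.
  by apply: (addrI (trace sep_e 0)); rewrite -traceD !addr0.
have [||||z zI zP] := @ideal_central_unit _ _ _ sep_e _ _ chi_surj _ rho I rep.
- by move=> c d; rewrite mulr0 mul0r trace0 chi_ker rmorph0.
- move=> x y xI yI c d; rewrite mulrDr mulrDl traceD chi_ker rmorphD.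
  have /[!chi_ker]/eqP -> := xI c d; have /[!chi_ker]/eqP -> := yI c d.
  by rewrite addr0.
- by move=> x y xI c d; rewrite mulrA.
- by move=> x y xI c d; rewrite mulrA -mulrA.
apply: (red_ker kappaP).
have -> : a = rscale (1 : (A^c)^o) a by rewrite /rscale [RHS]mulr1.
have := zI 1 1; rewrite mul1r mulr1 chi_ker => /eqP.
have -> : trace sep_e (val z) = z.
  by apply: val_inj; rewrite /= (trace_val_central sep_e (valP z)).
by rewrite kM zP // => ->; rewrite scale0r mulmx0.
Qed.

(** If all forms take values in [m] at [v], the trace functionals show that the coordinates
    [psi_i v] lie in [mA], so [v] lies in [mM]: there are enough forms for
    [reduction_localized_basis]. *)
Lemma dual_basis_localized (M : rmodType A) (p : prime_idealr (center A)) :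
  (forall z, (z \in p) = (z \in m)) -> dual_basis M ->
  exists n (x : 'I_n -> over_center M), localized_basis p x.
Proof.
move=> pm Mdual; have fgM := dual_basis_fg Mdual.
have [n [kappa kappaP]] := reduction_exists chi_surj chi_ker fgM.
exists n.
apply: (reduction_localized_basis chi_surj chi_ker pm fgM kappaP) => v vm.
have [N [u [psi uP]]] := Mdual.
have -> : v = \sum_i center_scale (psi i v : A) (u i : over_center M).
  exact: uP.
apply: ideal_mul_sum => i.
have [t tm ->] : ideal_mul m (psi i v : over_center ((A^c)^o : rmodType A)).
  apply: trace_nondegenerate => c d.
  exact: (vm (trace_functional (psi i) c d)).
exists [seq (q.1, center_scale (q.2 : A) (u i : over_center M)) | q <- t].
  by move=> _ /mapP[q /tm qm ->].
rewrite big_map /center_scale /rscale scaler_suml; apply: eq_bigr => q _.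
exact: (esym (rscaleA (u i) (q.2 : A) (val q.1))).
Qed.

Lemma rank_localized_basis (M : rmodType A) (p : prime_idealr (center A)) :
  (forall z, (z \in p) = (z \in m)) -> dual_basis M ->
  exists x : 'I_(rank (over_center M) p) -> over_center M, localized_basis p x.
Proof.
move=> pm Mdual; have [n [x xP]] := dual_basis_localized pm Mdual.
apply: (@xgetPex _ 0%N
  [set n | exists x : 'I_n -> over_center M, localized_basis p x]%classic).
by exists n, x.
Qed.

Lemma residual_iso_exists (M N : rmodType A) (p : prime_idealr (center A)) n
    (x : 'I_n -> over_center M) (y : 'I_n -> over_center N) :
  (forall z, (z \in p) = (z \in m)) -> dual_basis M ->
  localized_basis p x -> localized_basis p y ->
  exists h : {linear M -> N}, residual_iso m h.
Proof.
move=> pm [r [u [psi uP]]] xP yP.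
have [kM kMP] := localized_basis_reduction chi_surj chi_ker pm xP.
have [kN kNP] := localized_basis_reduction chi_surj chi_ker pm yP.
have [rM repM kMM] := reduction_representation kMP.
have [rN repN kNM] := reduction_representation kNP.
have [H Hunit HC] := representation_iso sep_e chi_surj repM repN.
have [w wP] := choice (fun i => red_surj kNP (kM (u i) *m H)).
have [h hP] := dual_lift psi w; exists h.
have hE v : kN (h v) = kM v *m H.
  rewrite hP (red_sum kNP) [in RHS](uP v) (red_sum kMP) mulmx_suml.
  by apply: eq_bigr => i _; rewrite kNM wP -mulmxA -HC mulmxA -kMM.
split=> [t|v /(red_ideal_mul chi_ker kNP)].
  have [v vP] := red_surj kMP (kN t *m invmx H); exists v.
  by apply: (red_ker kNP); rewrite (redB kNP) hE vP mulmxKV // subrr.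
rewrite hE => vH; apply: (red_ker kMP).
by rewrite -[kM v](mulmxK Hunit) vH mul0mx.
Qed.
End Local.
End CentralSeparable.

(** * From residual to global isomorphisms *)

Lemma residual_iso_congr (A : nzRingType) (m : {pred center A})
    (M N : rmodType A) (h h' : M -> N) :
  (forall v, ideal_mul m (h' v - h v : over_center N)) ->
  residual_iso m h -> residual_iso m h'.
Proof.
move=> hh' [hs hi]; split=> [y|v hv].
  have [x xP] := hs y; exists x.
  have -> : y - h' x = (y - h x) - (h' x - h x) by rewrite opprB addrA subrK.
  exact: (ideal_mulB (M := over_center N) xP (hh' x)).
apply: hi; have -> : h v = h' v - (h' v - h v) by rewrite opprB addrC subrK.
exact: (ideal_mulB (M := over_center N) hv (hh' v)).
Qed.

(** The result agrees with [h] modulo an ideal containing [z], and with [h1] modulo one containing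
    [1 - z]; this is the gluing step. With the identity, [p - q] and 1/2 for [h], [h1] and [z], it
    also yields the corrected projection onto a Lagrangian. *)
Lemma linear_combination_center (A : nzRingType) (M N : rmodType A)
    (h h1 : {linear M -> N}) (z : center A) :
  exists h' : {linear M -> N}, forall v,
    h' v = h v + rscale (h1 v - h v) (val z).
Proof.
pose hf v := h v + rscale (h1 v - h v) (val z).
have hlin : linear hf.
  move=> a u v; rewrite /hf.
  have -> : h1 (a *: u + v) - h (a *: u + v) = a *: (h1 u - h u) + (h1 v - h v).
    by rewrite (linearP h) (linearP h1) opprD addrACA scalerBr.
  rewrite rscaleDl (linearP h) [in RHS]scalerDr [RHS]addrACA.
  congr (_ + (_ + _)).
  rewrite /rscale !scalerA; congr (_ *: _).
  by have /centralP zC := valP z; exact: (esym (zC a)).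
pose h' : {linear M -> N} := HB.pack hf (GRing.isLinear.Build _ _ _ _ hf hlin).
by exists h'.
Qed.

(** By maximality each [F i] contains an element outside [m]; the product of these is outside [m],
    which is prime, and is then normalized to 1 modulo [m]. *)
Lemma maximal_ideals_separated (Z : comNzRingType) (F : nat -> {pred Z}) t
    (m : {pred Z}) :
  maximal_ideal m -> (forall i, (i < t)%N -> maximal_ideal (F i)) ->
  (forall i, (i < t)%N -> F i <> m) ->
  exists2 z, 1 - z \in m & forall i, (i < t)%N -> z \in F i.
Proof.
move=> mmax Fmax Fm.
have [p pm] := maximal_ideal_prime mmax.
have [x xm xF] : exists2 x, x \notin m & forall i, (i < t)%N -> x \in F i.
  elim: t Fmax Fm => [|t IHt] Fmax Fm.
    by exists 1 => //; case: mmax => -[].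
  have [i ti|i ti|x xm xF] := IHt; [by apply/Fmax/ltnW|by apply/Fm/ltnW|].
  have [y yF ym] : exists2 y, y \in F t & y \notin m.
    apply: contrapT => Fsub; apply: (Fm t) => //.
    have FtM : {subset F t <= m}.
      by move=> y yF; apply/negPn/negP => ym; apply: Fsub; exists y.
    have mFt := (Fmax t (ltnSn t)).2 m mmax.1 FtM.
    by apply/funext => y; apply/idP/idP; [exact: FtM|exact: mFt].
  exists (x * y).
    by rewrite -pm prime_idealrM negb_or !pm xm.
  move=> i; rewrite ltnS leq_eqVlt => /orP[/eqP ->|ti].
    have [[F0 _ FP] _] := Fmax t (ltnSn t).
    by rewrite -[_ * _]addr0; apply: FP.
  have [[F0 _ FP] _] := Fmax i (ltnW ti).
  by rewrite mulrC -[_ * _]addr0; apply: FP => //; apply: xF.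
have [y yP] := maximal_ideal_inv mmax xm; exists (y * x) => // i ti.
have [[F0 _ FP] _] := Fmax i ti.
by rewrite -[_ * _]addr0; apply: FP => //; apply: xF.
Qed.

Section ModuleIso.
Variables (A : nzRingType) (M N : rmodType A).
Hypothesis semilocalZ : semilocal (center A).
Hypothesis local_iso : forall m : {pred center A}, maximal_ideal m ->
  exists h : {linear M -> N}, residual_iso m h.

Lemma residual_iso_global : exists h : {linear M -> N},
  forall m : {pred center A}, maximal_ideal m -> residual_iso m h.
Proof.
have [ms msE] := (finite_seqP _).1 semilocalZ.
pose F i := nth (pred0 : center A -> bool) ms i.
have Fmax i : (i < size ms)%N -> maximal_ideal (F i).
  move=> lt_i; have : [set` ms]%classic (F i) by exact: mem_nth.
  by rewrite -msE.
suff [h hP] : exists h : {linear M -> N},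
    forall i, (i < size ms)%N -> residual_iso (F i) h.
  exists h => m mmax; have : [set` ms]%classic m by rewrite -msE.
  by move=> /= /(nthP (pred0 : center A -> bool))[i lt_i <-]; apply: hP.
elim: (size ms) Fmax => [|t IHt] Fmax; first by exists \0.
have [i ti|h hP] := IHt; first exact/Fmax/ltnW.
(* The enumeration may repeat an ideal. A repeated one is already settled, and [F t] can be
   separated only from ideals different from it. *)
have [[i ti Fi]|Fneq] := pselect (exists2 i, (i < t)%N & F i = F t).
  exists h => j; rewrite ltnS leq_eqVlt => /orP[/eqP ->|tj]; last exact: hP.
  by rewrite -Fi; apply: hP.
have Ft := Fmax t (ltnSn t).
have [||z z1 zF] := @maximal_ideals_separated _ F t (F t) Ft.
- by move=> i ti; exact/Fmax/ltnW.
- by move=> i ti Fi; apply: Fneq; exists i.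
have [h1 h1P] := local_iso Ft.
have [h' h'P] := linear_combination_center h h1 z.
exists h' => i; rewrite ltnS leq_eqVlt => /orP[/eqP ->|ti].
  apply: residual_iso_congr h1P => v; rewrite h'P.
  have -> : h v + rscale (h1 v - h v) (val z) - h1 v =
      (1 - z) *: (h v - h1 v : over_center N).
    rewrite scalerBl scale1r addrAC; congr (_ + _).
    by rewrite -scalerN opprB.
  exact: ideal_mul_scale.
apply: residual_iso_congr (hP i ti) => v; rewrite h'P addrAC subrr add0r.
exact: (@ideal_mul_scale _ _ (over_center N) z (h1 v - h v) (zF i ti)).
Qed.

Lemma module_iso : finitely_generated (over_center M) ->
  finitely_generated (over_center N) -> dual_basis N ->
  exists (h : {linear M -> N}) (g : {linear N -> M}), cancel h g /\ cancel g h.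
Proof.
move=> fgM fgN [n [u [psi uP]]]; have [h hP] := residual_iso_global.
have hsurj y : exists x, h x = y.
  apply: (@nakayama _ (over_center N) (fun y => exists x, h x = y)) => //.
  - by exists 0; rewrite linear0.
  - move=> z v w [x <-] [x' <-]; exists (rscale x (val z) + x').
    by rewrite linearD rscale_lin.
  - move=> m mmax v; have [x xP] := (hP m mmax).1 v.
    by exists (h x) => //; exists x.
have [w wP] := choice (fun i => hsurj (u i)).
have [g gP] := dual_lift psi w.
have gK : cancel g h.
  move=> y; rewrite gP linear_sum [RHS]uP; apply: eq_bigr => i _.
  by rewrite rscale_lin wP.
exists h, g; split=> // x.
have [y ->] : exists y, x = g y.
  apply: (@nakayama _ (over_center M) (fun x => exists y, x = g y)) => //.
  - by exists 0; rewrite linear0.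
  - move=> z v v' [y ->] [y' ->]; exists (rscale y (val z) + y').
    by rewrite linearD rscale_lin.
  - move=> m mmax v; exists (g (h v)); first by exists (h v).
    apply: (hP m mmax).2; rewrite linearB gK subrr.
    exact: (@ideal_mul0 _ _ (over_center N)).
by rewrite gK.
Qed.
End ModuleIso.

(** * Semilocality of the center *)

Section CenterSemilocal.
Variables (R : comNzRingType) (A : algType R) (sigma : {linear A -> A}).
Hypothesis azumayaA : azumaya_with_involution sigma.

Let sigmaM := involution_antimul azumayaA.
Let sigmaK := involution_invol azumayaA.

Lemma involution1 : sigma 1 = 1.
Proof.
by have := sigmaM (sigma 1) 1; rewrite mulr1 sigmaK mulr1.
Qed.

Lemma involution_central z : z \in central A -> sigma z \in central A.
Proof.
move=> /centralP zC; apply/centralP => a.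
by rewrite -[a]sigmaK -!sigmaM zC.
Qed.

Definition center_involution (z : center A) : center A :=
  Sub (sigma (val z)) (involution_central (valP z)).

Lemma center_involutionD y z :
  center_involution (y + z) = center_involution y + center_involution z.
Proof. by apply: val_inj; rewrite /= linearD. Qed.

Lemma center_involutionM y z :
  center_involution (y * z) = center_involution y * center_involution z.
Proof.
apply: val_inj; rewrite /= sigmaM.
by have /centralP := involution_central (valP z); apply.
Qed.

Lemma center_involutionK : involutive center_involution.
Proof. by move=> z; apply: val_inj; rewrite /= sigmaK. Qed.

Lemma center_fixed z : center_involution z = z ->
  exists r : R, z = scalar_center A r.
Proof.
move=> /(congr1 val) /= zs.
have [r rE] := (azumaya_fixed azumayaA (val z)).1 (conj (valP z) zs).
by exists r; apply: val_inj.
Qed.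

Lemma center_norm z : exists r : R, z * center_involution z = scalar_center A r.
Proof.
by apply: center_fixed; rewrite center_involutionM center_involutionK mulrC.
Qed.

Lemma center_trace z :
  exists r : R, z + center_involution z = scalar_center A r.
Proof.
by apply: center_fixed; rewrite center_involutionD center_involutionK addrC.
Qed.

Definition contraction (m : {pred center A}) : R -> bool :=
  fun r => scalar_center A r \in m.

(** An inverse [z] of [r] modulo [m] lives only in the center. The norm [(1 - z r)(1 - z^sigma r)]
    lies in [m] and comes from [R]; expanding it shows that [t - r * n] is an inverse in [R], with
    [t] the trace and [n] the norm of [z]. *)
Lemma contraction_maximal m : maximal_ideal m -> maximal_ideal (contraction m).
Proof.
move=> mmax; have [[m0 m1 mP] _] := mmax.
split.
  split=> [||a r t rm tm].
  - by rewrite -[_ \in _]/(scalar_center A 0 \in m) rmorph0.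
  - by rewrite -[_ \in _]/(scalar_center A 1 \in m) rmorph1.
  - by rewrite -[_ \in _]/(scalar_center A _ \in m) rmorphD rmorphM; apply: mP.
move=> J [J0 J1 JP] mJ r rJ; apply/negPn/negP => rm.
have {}rm : scalar_center A r \notin m by [].
have [z zr] := maximal_ideal_inv mmax rm.
have [n nE] := center_norm z; have [t tE] := center_trace z.
have kJ : 1 - (t - r * n) * r \in J.
  apply: mJ; rewrite -[_ \in _]/(scalar_center A _ \in m).
  rewrite rmorphB rmorph1 rmorphM rmorphB rmorphM.
  rewrite /= -nE -tE; set y := scalar_center A r.
  have -> : 1 - (z + center_involution z - y * (z * center_involution z)) * y =
    (1 - center_involution z * y) * (1 - z * y) + 0 by ring.
  exact: mP.
case/negP: J1; have -> : 1 = (t - r * n) * r + (1 - (t - r * n) * r) by ring.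
exact: JP.
Qed.

(** For [x] in [m'], the norm of [x] comes from the common contraction, so [x] or its conjugate lies
    in the prime ideal [m]. Thus [m'] is covered by [m] and its conjugate, hence contained in one of
    them, and equal to it by maximality. *)
Lemma fiber_contraction (m m' : {pred center A}) :
  maximal_ideal m -> maximal_ideal m' -> contraction m = contraction m' ->
  m' = m \/ m' = (fun z => center_involution z \in m).
Proof.
move=> mmax mmax' mm'; have [p pm] := maximal_ideal_prime mmax.
have [[m0 m1 mP] _] := mmax; have [[m0' m1' mP'] m'max] := mmax'.
pose ms : {pred center A} := fun z => center_involution z \in m.
have ci0 : center_involution 0 = 0 by apply: val_inj; rewrite /= linear0.
have ci1 : center_involution 1 = 1 by apply: val_inj; rewrite /= involution1.
have msI : idealr_closed ms.
  split=> [||a u v um vm].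
  - by rewrite -[_ \in _]/(center_involution 0 \in m) ci0.
  - by rewrite -[_ \in _]/(center_involution 1 \in m) ci1.
  rewrite -[_ \in _]/(center_involution _ \in m).
  by rewrite center_involutionD center_involutionM; apply: mP.
have cover x : x \in m' -> (x \in m) || (x \in ms).
  move=> xm'; have [r rE] := center_norm x.
  have : contraction m r.
    by rewrite mm' /contraction -rE mulrC -[_ * _]addr0; apply: mP'.
  by rewrite /contraction -rE -pm prime_idealrM !pm.
have [sub|nsub] := pselect {subset m' <= m}.
  left; apply/funext => z; apply/idP/idP; first exact: sub.
  exact: (m'max _ mmax.1 sub).
right; have sub : {subset m' <= ms}.
  move=> b bm'; case/boolP: (b \in ms) => // bms; exfalso; apply: nsub => a am'.
  case/boolP: (a \in m) => // am; exfalso.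
  have bm : b \in m by have := cover b bm'; rewrite (negPf bms) orbF.
  have ams : a \in ms by have := cover a am'; rewrite (negPf am).
  have : 1 * a + b \in m' by apply: mP'.
  move/cover; case/orP => abm.
    case/negP: am; have -> : a = (-1) * b + (1 * a + b) by ring.
    exact: mP.
  have [_ _ msP] := msI.
  case/negP: bms; have -> : b = (-1) * a + (1 * a + b) by ring.
  exact: msP.
by apply/funext => z; apply/idP/idP; [exact: sub|exact: (m'max _ msI sub)].
Qed.

Lemma center_semilocal : semilocal R -> semilocal (center A).
Proof.
move=> semiR; rewrite /semilocal.
pose fiber (r : R -> bool) : set (center A -> bool) :=
  [set m : center A -> bool | maximal_ideal m /\ contraction m = r]%classic.
have fin_fiber r : finite_set (fiber r).
  have [[m [mmax mr]]|none] :=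
    pselect (exists m : center A -> bool, fiber r m); last first.
    by apply: (@sub_finite_set _ _ set0) => // m mr; case: none; exists m.
  apply: (@sub_finite_set _ _
    [set m; (fun z => m (center_involution z)) : center A -> bool]%classic).
    move=> m' [m'max m'r].
    have [->|->] := fiber_contraction mmax m'max (etrans mr (esym m'r)).
      by left.
    by right.
  exact: finite_set2.
have := bigcup_finite semiR (fun r _ => fin_fiber r).
apply: sub_finite_set => m mmax; exists (contraction m) => //=.
exact: contraction_maximal.
Qed.
End CenterSemilocal.

(** * Hermitian forms and Lagrangians *)

Section DualBases.
Variable S : nzRingType.

Lemma projective_dual_basis (M : lmodType S) :
  finitely_generated M -> projective M -> dual_basis M.
Proof.
move=> [n [u gen]] projM.
pose ev (c : {ffun 'I_n -> S^o}) : M := \sum_i (c i : S) *: u i.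
have ev_lin : linear ev.
  move=> a c d; rewrite /ev scaler_sumr -big_split; apply: eq_bigr => i _ /=.
  by rewrite !ffunE scalerDl scalerA.
pose evl : {linear {ffun 'I_n -> S^o} -> M} :=
  HB.pack ev (GRing.isLinear.Build _ _ _ _ ev ev_lin).
have [|k kP] := projM _ _ evl (idfun : {linear M -> M}).
  by move=> y; have [c ->] := gen y; exists [ffun i => c i];
    apply: eq_bigr => i _; rewrite ffunE.
pose psi i (v : M) : S^o := k v i.
have psi_lin i : linear (psi i).
  by move=> a v w; rewrite /psi linearP !ffunE.
pose psil i : {linear M -> S^o} :=
  HB.pack (psi i) (GRing.isLinear.Build _ _ _ _ (psi i) (psi_lin i)).
by exists n, u, psil => v; rewrite -[LHS](kP v).
Qed.

Lemma dual_basis_retract (M N : lmodType S) (i : {linear N -> M})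
    (p : {linear M -> N}) : cancel i p -> dual_basis M -> dual_basis N.
Proof.
move=> ip [n [u [psi uP]]].
exists n, (fun j => p (u j)), (fun j => psi j \o i : {linear N -> S^o}) => v.
rewrite -[LHS]ip [i v in LHS]uP linear_sum; apply: eq_bigr => j _.
by rewrite linearZ.
Qed.

Lemma summand_projection (M : lmodType S) (L : submodClosed M) :
  direct_summand L -> exists p : {linear M -> submod_type L}, cancel val p.
Proof.
move=> [L' [dec dis]].
have /choice[q qP] : forall x, exists u : submod_type L, x - val u \in L'.
  move=> x; have [u [v [uL vL ->]]] := dec x.
  by exists (Sub u uL); rewrite /= addrC addKr.
have q_uniq x (u : submod_type L) : x - val u \in L' -> q x = u.
  move=> xu; apply/eqP; rewrite -subr_eq0; apply/eqP/val_inj.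
  apply: dis; first exact: valP.
  have -> : val (q x - u) = (x - val u) - (x - val (q x)).
    by rewrite raddfB /= opprB [RHS]addrC addrA subrK.
  rewrite -[- (x - _)]scaleN1r; apply: rpredD => //; exact: rpredZ.
have q_lin : linear q.
  move=> a x y; apply: q_uniq.
  rewrite -[val _]/(a *: val (q x) + val (q y)) opprD addrACA -scalerBr.
  by apply: rpredD => //; apply: rpredZ.
pose ql : {linear M -> submod_type L} :=
  HB.pack q (GRing.isLinear.Build _ _ _ _ q q_lin).
by exists ql => u; apply: q_uniq; rewrite subrr rpred0.
Qed.
End DualBases.

Lemma localized_basis_map (Z : comNzRingType) (M N : lmodType Z)
    (h : {linear M -> N}) (p : prime_idealr Z) n (x : 'I_n -> M) :
  injective h -> (forall y, exists x, h x = y) ->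
  localized_basis p (h \o x) <-> localized_basis p x.
Proof.
move=> hinj hsurj.
have hE (c : 'I_n -> Z) : \sum_i c i *: h (x i) = h (\sum_i c i *: x i).
  by rewrite linear_sum; apply: eq_bigr => i _; rewrite linearZ.
split=> -[span indep]; split.
- move=> v; have [s [c [sp sv]]] := span (h v); exists s, c; split=> //.
  by apply: hinj; rewrite linearZ /= sv -hE.
- by move=> c c0; apply: indep; rewrite /= hE c0 linear0.
- move=> y; have [v <-] := hsurj y; have [s [c [sp sv]]] := span v.
  by exists s, c; split=> //; rewrite /= hE -sv linearZ.
- move=> c; rewrite /= hE => c0; apply: indep; apply: hinj.
  by rewrite c0 linear0.
Qed.

Lemma rank_iso (Z : comNzRingType) (M N : lmodType Z)
    (h : {linear M -> N}) (p : prime_idealr Z) :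
  injective h -> (forall y, exists x, h x = y) -> rank M p = rank N p.
Proof.
move=> hinj hsurj; rewrite /rank; congr (xget _ _).
apply/seteqP; split=> n [x xP].
  by exists (h \o x); apply/localized_basis_map.
have [y yx] := choice (fun i => hsurj (x i)); exists y.
apply/(localized_basis_map _ _ hinj hsurj).
by have -> : h \o y = x by apply/funext => i; rewrite /= yx.
Qed.

Section Hermitian.
Variables (R : comNzRingType) (A : algType R) (sigma : {linear A -> A}).
Hypothesis azumayaA : azumaya_with_involution sigma.
Variables (eps : A) (P : rmodType A) (f : P -> P -> A).
Hypothesis fH : unimodular_hermitian sigma eps f.

Let sigma1 := involution1 azumayaA.

Lemma form_scaler x y a : f x (rscale y a) = f x y * a.
Proof.
by have := herm_sesqui fH x y 1 a; rewrite rscale1 sigma1 mul1r.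
Qed.

Lemma form_scalel x y a : f (rscale x a) y = sigma a * f x y.
Proof.
by have := herm_sesqui fH x y a 1; rewrite rscale1 mulr1.
Qed.

Lemma form_linear x : exists g : {linear P -> (A^c)^o}, forall y, g y = f x y.
Proof.
have g_lin : linear (f x : P -> (A^c)^o).
  move=> a y z; rewrite (herm_addr fH); congr (_ + _).
  exact: form_scaler.
pose fx y : (A^c)^o := f x y.
pose g : {linear P -> (A^c)^o} :=
  HB.pack fx (GRing.isLinear.Build _ _ _ _ fx g_lin).
by exists g.
Qed.

Lemma form_inj x x' : (forall y, f x y = f x' y) -> x = x'.
Proof.
move=> xx'; have [g gP] := form_linear x.
have [w [_ uniq_w]] := herm_unimodular fH g.
have <- : w = x by apply: uniq_w => y; rewrite gP.
by apply: uniq_w => y; rewrite gP xx'.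
Qed.

Lemma formDl x x' y : f (x + x') y = f x y + f x' y.
Proof. exact: herm_addl fH x x' y. Qed.

Lemma formDr x y y' : f x (y + y') = f x y + f x y'.
Proof. exact: herm_addr fH x y y'. Qed.

Lemma form0l y : f 0 y = 0.
Proof. by apply: (addrI (f 0 y)); rewrite -formDl !addr0. Qed.

Lemma form0r y : f y 0 = 0.
Proof. by apply: (addrI (f y 0)); rewrite -formDr !addr0. Qed.

Lemma formBl x x' y : f (x - x') y = f x y - f x' y.
Proof. by apply/eqP; rewrite eq_sym subr_eq -formDl subrK. Qed.

Lemma formBr x y y' : f x (y - y') = f x y - f x y'.
Proof. by apply/eqP; rewrite eq_sym subr_eq -formDr subrK. Qed.

Lemma adjoint_exists (g : {linear P -> P}) :
  exists gs : {linear P -> P}, forall x y, f (gs x) y = f x (g y).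
Proof.
have /choice[gs gsP] : forall x, exists x', forall y, f x' y = f x (g y).
  move=> x; have [F FP] := form_linear x.
  have [x' [x'P _]] := herm_unimodular fH (F \o g : {linear P -> (A^c)^o}).
  by exists x' => y; rewrite x'P /= FP.
have gs_lin : linear gs.
  move=> a x y; apply: form_inj => z; rewrite formDl !gsP formDl; congr (_ + _).
  by rewrite [LHS]form_scalel [RHS]form_scalel gsP.
pose gsl : {linear P -> P} :=
  HB.pack gs (GRing.isLinear.Build _ _ _ _ gs gs_lin).
by exists gsl.
Qed.

Lemma adjoint_right (g gs : P -> P) : (forall x y, f (gs x) y = f x (g y)) ->
  forall x y, f x (gs y) = f (g x) y.
Proof.
move=> gsP x y.
by rewrite (herm_sym fH) gsP -(herm_sym fH).
Qed.

(** The identity says that [e] and its adjoint add up to 1. As [L] is isotropic, the adjoint [ps] of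
    [p] kills [L], so [E = (1 + p - ps) / 2] is the identity on [L]; and [f (E x) y = 0] for [y] in
    [L], so [E x] lies in the orthogonal of [L], which is [L]. *)
Lemma lagrangian_projection (L : submodClosed P) :
  (exists u : R, 2%:R * u = 1) -> lagrangian f L ->
  exists e : {linear P -> submod_type L}, cancel val e /\
    forall x y, f x y = f (val (e x)) y + f x (val (e y)).
Proof.
move=> [r r2] [sumL LP]; have [p pK] := summand_projection sumL.
pose t : center A := scalar_center A r.
have /centralP tC := valP t.
have t_sigma : sigma (val t) = val t by rewrite linearZ sigma1.
have half a : val t * a + val t * a = a.
  by rewrite -mulrDl /= -scalerDl -mulr2n -mulr_natl r2 scale1r mul1r.
have [ps psP] := adjoint_exists (val \o p : {linear P -> P}).
have psR := adjoint_right psP.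
have [E EP] := linear_combination_center (idfun : {linear P -> P})
  ((val \o p) \- ps : {linear P -> P}) t.
have isoL x y : x \in L -> y \in L -> f x y = 0 by move=> /LP + yL; apply.
have fE x y : f (E x) y =
    f x y + val t * (f (val (p x)) y - f x (val (p y)) - f x y).
  by rewrite EP /= formDl form_scalel t_sigma !formBl psP.
have fER x y : f x (E y) =
    f x y + val t * (f x (val (p y)) - f (val (p x)) y - f x y).
  by rewrite EP /= formDr form_scaler tC !formBr psR.
have EL x : E x \in L.
  apply/LP => y yL; rewrite fE; have -> : val (p y) = y.
    by rewrite -[y in LHS]/(val (Sub y yL : submod_type L)) pK.
  rewrite (isoL _ _ (valP (p x)) yL) sub0r -opprD mulrN mulrDr half.
  by rewrite subrr.
exists (p \o E : {linear P -> submod_type L}).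
have eE x : val (p (E x)) = E x.
  by rewrite -[E x in LHS]/(val (Sub (E x) (EL x) : submod_type L)) pK.
split=> [l|x y].
  apply: val_inj; rewrite /= eE; apply: form_inj => y.
  rewrite fE pK (isoL _ _ (valP l) (valP (p y))) subr0 subrr mulr0.
  by rewrite addr0.
rewrite /= !eE fE fER; set a := f x y; set b := f (val _) _; set c := f x _.
rewrite addrACA -mulrDr.
have -> : b - c - a + (c - b - a) = - (a + a).
  by rewrite addrACA -opprB addNr add0r opprD.
by rewrite mulrN mulrDr half addrK.
Qed.

(** The adjoint [psi] is a left inverse. The difference [phi (psi y) - y] is orthogonal to the image
    of [phi], which contains [L'], so it lies in [L'] and is some [phi l]; then [l] is orthogonal to
    all of [P] and vanishes. *)
Lemma isometry_surjective (phi : {linear P -> P}) (L L' : submodClosed P) :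
  (forall x y, f (phi x) (phi y) = f x y) -> lagrangian f L' ->
  submod_image phi L =i L' -> bijective phi.
Proof.
move=> phiP [_ LP'] phiL; have [psi psiP] := adjoint_exists phi.
exists psi => y; first by apply: form_inj => z; rewrite psiP phiP.
have orth z : f (phi (psi y) - y) (phi z) = 0.
  by rewrite formBl phiP psiP subrr.
have : phi (psi y) - y \in L'.
  by apply/LP' => w; rewrite -phiL => /asboolP[z _ <-].
rewrite -phiL => /asboolP[l _ lE].
have l0 : l = 0 by apply: form_inj => z; rewrite form0l -phiP lE orth.
by apply/eqP; rewrite -subr_eq0 -lE l0 linear0.
Qed.

(** The extension is [h] on [L] and, on the kernel of [e], the adjoint [k] of [g \o e']. Only mixed
    terms contribute to [f (phi x) (phi y)]; they are [f (e x) y] and [f x (e y)], with sum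
    [f x y]. *)
Lemma lagrangian_iso_extends (L L' : submodClosed P)
    (h : {linear submod_type L -> submod_type L'})
    (g : {linear submod_type L' -> submod_type L}) :
  (exists u : R, 2%:R * u = 1) -> lagrangian f L -> lagrangian f L' ->
  cancel h g -> cancel g h ->
  exists2 phi : {linear P -> P},
    isometry_group f phi & submod_image phi L =i L'.
Proof.
move=> half lagL lagL' hK gK.
have [e [eK eP]] := lagrangian_projection half lagL.
have [e' [eK' eP']] := lagrangian_projection half lagL'.
have isoL x y : x \in L -> y \in L -> f x y = 0.
  by move=> /lagL.2 + yL; apply.
have isoL' x y : x \in L' -> y \in L' -> f x y = 0.
  by move=> /lagL'.2 + yL; apply.
have [k kP] := adjoint_exists (val \o (g \o e') : {linear P -> P}).
pose phi : {linear P -> P} :=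
  (val \o (h \o e)) \+ (k \o (idfun \- (val \o e))).
have phiE x : phi x = val (h (e x)) + k (x - val (e x)) by [].
have phiL (l : submod_type L) : phi (val l) = val (h l).
  by rewrite phiE eK subrr linear0 addr0.
have imL : submod_image phi L =i L'.
  move=> w; apply/asboolP/idP => [[l lL <-]|wL].
    by rewrite -[l]/(val (Sub l lL : submod_type L)) phiL; exact: valP.
  pose w' : submod_type L' := Sub w wL.
  by exists (val (g w')); [exact: valP|rewrite phiL gK].
(* By [eP'], [f (e' (k x)) z] is [f (k x) z] minus [f (k x) (e' z)], and both of these equal
   [f x (g (e' z))]. *)
have ek' x : e' (k x) = 0.
  apply: val_inj; apply: form_inj => z; rewrite form0l.
  apply: (addIr (f (k x) (val (e' z)))).
  by rewrite -eP' add0r !kP /= eK'.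
have phi_iso x y : f (phi x) (phi y) = f x y.
  rewrite !phiE formDl !formDr.
  rewrite (isoL' _ _ (valP (h (e x))) (valP (h (e y)))) add0r.
  rewrite (adjoint_right kP) !kP /= !eK' !hK ek' !linear0 form0r addr0.
  rewrite formBl formBr !(isoL _ _ (valP _) (valP _)) !subr0.
  by rewrite -eP.
exists phi => //; split=> //; exact: (isometry_surjective phi_iso lagL' imL).
Qed.

Lemma isometry_lagrangian (phi : {linear P -> P}) (L : submodClosed P) :
  isometry_group f phi -> lagrangian f L -> lagrangian f (submod_image phi L).
Proof.
move=> [[psi phiK psiK] phiP] [[L' [dec dis]] LP]; split.
  exists (submod_image phi L' : submodClosed P).
  split=> [x|_ /asboolP[u uL <-] /asboolP[v vL uv]].
    have [u [v [uL vL xE]]] := dec (psi x).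
    exists (phi u), (phi v); split; [by apply/asboolP; exists u| |].
      by apply/asboolP; exists v.
    by rewrite -linearD -xE psiK.
  have vu : v = u by rewrite -[v]phiK uv phiK.
  by rewrite (dis u uL) ?linear0 // -vu.
move=> x; split=> [/asboolP[u /LP uL <-] _ /asboolP[v vL <-]|xL].
  by rewrite phiP; apply: uL.
apply/asboolP; exists (psi x) => //; apply/LP => y yL.
by rewrite -phiP psiK; apply: xL; apply/asboolP; exists y.
Qed.

Lemma submod_image_rank (phi : {linear P -> P}) (L : submodClosed P)
    (p : prime_idealr (center A)) : injective phi ->
  rank (over_center (submod_type (submod_image phi L))) p =
  rank (over_center (submod_type L)) p.
Proof.
move=> phi_inj.
have im (l : submod_type L) : phi (val l) \in submod_image phi L.
  by apply/asboolP; exists (val l) => //; exact: valP.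
pose h (l : submod_type L) : submod_type (submod_image phi L) :=
  Sub (phi (val l)) (im l).
have h_lin : linear h by move=> a u v; apply: val_inj; rewrite /= linearP.
pose hl : {linear submod_type L -> submod_type (submod_image phi L)} :=
  HB.pack h (GRing.isLinear.Build _ _ _ _ h h_lin).
symmetry; apply: (rank_iso (h := center_map hl)) => [u v|w].
  by move=> /(congr1 val) /= /phi_inj /val_inj.
have /asboolP[l lL lw] := valP (w : submod_type (submod_image phi L)).
by exists (Sub l lL : submod_type L); apply: val_inj.
Qed.

(** A localized basis of length 0 would kill 1 by an element outside [p], which is then 0.
    Nonvanishing allows the degree to be cancelled from equal reduced ranks. *)
Lemma degree_neq0 (m : {pred center A}) (p : prime_idealr (center A)) :
  maximal_ideal m -> (forall z, (z \in p) = (z \in m)) -> degree p != 0.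
Proof.
move=> mmax pm; have [k [chi [chi_surj chi_ker]]] := residue_field mmax.
have [s s_dual [e sep_e]] :=
  separable_finite (azumaya_projective azumayaA) (azumaya_separable azumayaA).
have [x [span _]] := rank_localized_basis s_dual sep_e chi_surj chi_ker pm
  (regular_dual_basis A).
rewrite /degree sqrtC_eq0 pnatr_eq0; apply/eqP => r0.
have [z [c [zp]]] := span (1 : A).
rewrite big1 => [/(congr1 (fun v => v : A)) z0|i _]; last first.
  by have := ltn_ord i; rewrite [X in (_ < X)%N]r0.
have zE : z = 0 by apply: val_inj; rewrite -[LHS]mul1r; exact: z0.
by move: zp; rewrite zE rpred0.
Qed.

(** Both reduced ranks are half that of [P]. At the primes that are maximal, cancelling the degree
    gives the equality of basis lengths that [residual_iso_exists] requires. *)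
Lemma Lag_module_iso (L L' : submodClosed P) :
  semilocal R -> Lag f L -> Lag f L' ->
  exists (h : {linear submod_type L -> submod_type L'})
    (g : {linear submod_type L' -> submod_type L}), cancel h g /\ cancel g h.
Proof.
move=> semiR [[sumL _] rkL] [[sumL' _] rkL'].
have [s s_dual [e sep_e]] :=
  separable_finite (azumaya_projective azumayaA) (azumaya_separable azumayaA).
have dualP := projective_dual_basis (herm_fg fH) (herm_projective fH).
have [q qK] := summand_projection sumL.
have dualL := dual_basis_retract qK dualP.
have [q' qK'] := summand_projection sumL'.
have dualL' := dual_basis_retract qK' dualP.
apply: module_iso => //; try exact: (dual_basis_fg s_dual).
  exact: (center_semilocal azumayaA).
move=> m mmax; have [p pm] := maximal_ideal_prime mmax.
have [k [chi [chi_surj chi_ker]]] := residue_field mmax.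
have [x xP] := rank_localized_basis s_dual sep_e chi_surj chi_ker pm dualL.
have [y yP] := rank_localized_basis s_dual sep_e chi_surj chi_ker pm dualL'.
have rkE : rank (over_center (submod_type L)) p =
    rank (over_center (submod_type L')) p.
  have := rkL p; rewrite -(rkL' p) /rrk => /(mulIf _) H.
  by apply/eqP; rewrite -(eqr_nat algC) H // invr_eq0 (degree_neq0 mmax pm).
move: x xP y yP; rewrite rkE => x xP y yP.
exact: (residual_iso_exists sep_e chi_surj chi_ker pm dualL xP yP).
Qed.
End Hermitian.

Theorem lemma2p22 (R : comNzRingType) (R_semilocal : semilocal R)
    (two_unit : exists u : R, 2%:R * u = 1)
    (A : algType R) (sigma : {linear A -> A})
    (A_azumaya : azumaya_with_involution sigma)
    (eps : A) (eps_central : eps \in central A)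
    (eps_unitary : sigma eps * eps = 1)
    (P : rmodType A) (f : P -> P -> A)
    (f_hermitian : unimodular_hermitian sigma eps f)
    (Lag_nonempty : exists L : submodClosed P, Lag f L) :
  (forall (phi : {linear P -> P}) (L : submodClosed P),
     isometry_group f phi -> Lag f L -> Lag f (submod_image phi L)) /\
  (forall L L' : submodClosed P, Lag f L -> Lag f L' ->
     exists2 phi : {linear P -> P},
       isometry_group f phi & submod_image phi L =i L').
Proof.
split=> [phi L phiP [lagL rkL]|L L' lagL lagL'].
  split; first exact: (isometry_lagrangian phiP lagL).
  by move=> p; rewrite -rkL /rrk submod_image_rank //; exact: bij_inj phiP.1.
have [h [g [hK gK]]] :=
  Lag_module_iso A_azumaya f_hermitian R_semilocal lagL lagL'.
exact: (lagrangian_iso_extends A_azumaya f_hermitian two_unit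
  lagL.1 lagL'.1 hK gK).
Qed.
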